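(* Let $U$ be an almost-canonically seminormed ring with zeroth Zhu algebra $\mathsf A_0$. If $U$ is $\mathsf A_0$-rational, then the strong identity condition holds for $U$.
   Context: Conventions: $\Bbbk$ is a fixed commutative ring, rings are unital associative $\Bbbk$-algebras, $\mathbb N=\{0,1,2,\dots\}$; an $(S|T)$-bimodule has a left $S$- and a right $T$-action. Almost-canonically seminormed ring: a $\mathbb Z$-graded ring $U=\bigoplus_pU_p$ with a decreasing family of graded subspaces $\mathsf N_{\mathsf L}^nU$ ($n\in\mathbb Z$), $\mathsf N_{\mathsf L}^nU_p=\mathsf N_{\mathsf L}^nU\cap U_p$, such that $U\cdot U_{\le -n}\subset\mathsf N_{\mathsf L}^nU$ and $\mathsf N_{\mathsf L}^nU_p=(U\,U_{\le -n})_p+\mathsf N_{\mathsf L}^{m}U_p$ for all $m\ge n$ and $p$; and $(\mathsf N_{\mathsf L}^nU_p)U_q\subset\mathsf N_{\mathsf L}^{n-q}U_{p+q}$, $U_p(\mathsf N_{\mathsf L}^nU_q)\subset\mathsf N_{\mathsf L}^nU_{p+q}$. Put $\mathsf N_{\mathsf R}^nU_p:=\mathsf N_{\mathsf L}^{n-p}U_p$. $\mathfrak L^0=U/\mathsf N_{\mathsf L}^{1}U$, $\mathfrak R^0=U/\mathsf N_{\mathsf R}^{1}U$, $\mathsf A_0=U_0/\mathsf N_{\mathsf L}^{1}U_0$. Mode transition algebra: for homogeneous $\alpha,\beta$ the pairing $\circledast:\mathfrak R^0\otimes_U\mathfrak L^0\to\mathsf A_0$ sends $[\alpha]\otimes[\beta]$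 to $[\alpha\beta]$ if $\deg\alpha+\deg\beta=0$ and to $0$ otherwise. $\mathfrak A=\mathfrak L^0\otimes_{\mathsf A_0}\mathfrak R^0$, $\mathfrak A_{p,-q}=\mathfrak L^0_p\otimes_{\mathsf A_0}\mathfrak R^0_{-q}$, $(a\otimes b)\star(a'\otimes b')=a\otimes(b\circledast a')b'$. Strong identity condition: there exist $\mathfrak 1_n\in\mathfrak A_{n,-n}$ ($n\in\mathbb N$) with $\mathfrak 1_n\star\mathfrak a=\mathfrak a=\mathfrak a\star\mathfrak 1_m$ for all $n,m\in\mathbb N$ and $\mathfrak a\in\mathfrak A_{n,-m}$. A positively-graded $(U|{}_R)$-bimodule is a $(U|R)$-bimodule $W=\bigoplus_{n\in\mathbb Z}W_n$ with $R$-submodules $W_n$, $U_pW_n\subset W_{p+n}$, and $W_n=0$ for $n\ll0$. It is quasi-rigid if each $W_n$ is a finitely generated projective right $R$-module. $U$ is $R$-rational if every positively-graded $(U|{}_R)$-bimodule is a direct sum of quasi-rigid simple ones (simple as graded bimodules). *)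

(* Defs.v *)
From HB Require Import structures.
From mathcomp Require Import all_boot all_order all_algebra.
From mathcomp Require Import generic_quotient ring_quotient.
From mathcomp Require Import boolp classical_sets functions cardinality fsbigop.
From mathcomp Require Import freeg.

Set Implicit Arguments.
Unset Strict Implicit.
Unset Printing Implicit Defensive.

Import Order.TTheory GRing.Theory Num.Theory.

Local Open Scope classical_set_scope.
Local Open Scope quotient_scope.
Local Open Scope ring_scope.

(* Unital associative k-algebras, as rings with a ring morphism from k to the
   center. The library structure algType k requires 1 != 0, which is too strong
   here: the algebra zhu below may be the zero ring even when U is not. *)
Record kalg (k : comPzRingType) := Kalg {
  kalg_ring :> pzRingType;
  kin : {rmorphism k -> kalg_ring};
  kin_central : forall (c : k) (x : kalg_ring), kin c * x = x * kin c
}.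

Section Subgroups.
Variable V : zmodType.

Definition subgroup (S : set V) :=
  S 0 /\ (forall x y, S x -> S y -> S (x - y)).

Inductive span (X : set V) : V -> Prop :=
| span_gen x : X x -> span X x
| span_0 : span X 0
| span_sub x y : span X x -> span X y -> span X (x - y).

Lemma span_subgroup (X : set V) : subgroup (span X).
Proof. by split; [exact: span_0 | exact: span_sub]. Qed.

Lemma subgroupN S x : subgroup S -> S x -> S (- x).
Proof. by move=> [S0 SB] Sx; rewrite -sub0r; exact: SB. Qed.

Lemma subgroupD S x y : subgroup S -> S x -> S y -> S (x + y).
Proof.
by move=> gS Sx Sy; rewrite -[y]opprK; apply: (proj2 gS) => //; exact: subgroupN.
Qed.

Definition in_subgroup (S : set V) of subgroup S : V -> bool :=
  fun x => `[< S x >].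

Variables (S : set V) (gS : subgroup S).

Fact in_subgroup_closed : zmod_closed (in_subgroup gS).
Proof.
split=> [|x y]; first by apply/asboolP; exact: (proj1 gS).
by move=> /asboolP Sx /asboolP Sy; apply/asboolP; exact: (proj2 gS).
Qed.

HB.instance Definition _ :=
  GRing.isZmodClosed.Build V (in_subgroup gS) in_subgroup_closed.

Definition subgroup_closed : zmodClosed V :=
  GRing.ZmodClosed.clone V (in_subgroup gS) _.

Definition quotient := Quotient.quot subgroup_closed.

HB.instance Definition _ := Choice.on quotient.
HB.instance Definition _ := Quotient.on quotient.
HB.instance Definition _ := GRing.Zmodule.on quotient.

Definition qclass (x : V) : quotient := \pi x.

Lemma qclassP x y : qclass x = qclass y <-> S (x - y).
Proof.
split=> [|Sxy].
  by move/eqP; rewrite -Quotient.idealrBE => /asboolP.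
by apply/eqP; rewrite -Quotient.idealrBE; apply/asboolP.
Qed.

Lemma qclassB : {morph qclass : x y / x - y}.
Proof. by move=> x y; rewrite /qclass [LHS](raddfB \pi_(Quotient.quot subgroup_closed)). Qed.

Lemma qclass_repr (a : quotient) : qclass (repr a) = a.
Proof. exact: reprK. Qed.

Lemma repr_qclass x : S (repr (qclass x) - x).
Proof. by apply/qclassP; rewrite qclass_repr. Qed.

End Subgroups.

HB.instance Definition _ (V : zmodType) (S : set V) (gS : subgroup S) :=
  GRing.isZmodMorphism.Build V (quotient gS) (qclass gS) (qclassB gS).

(* Tensor products over a possibly noncommutative ring A, for a right action ra
   on M and a left action la on N, as additive groups: the free abelian group on
   M * N modulo the usual relations. *)
Section Tensor.
Variables (A : Type) (M N : zmodType) (ra : M -> A -> M) (la : A -> N -> N).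

Definition ptensor (m : M) (n : N) : {freeg (M * N)%type / int} := << (m, n) >>.

Inductive tensor_rel : {freeg (M * N)%type / int} -> Prop :=
| tensor_relDl m m' n :
    tensor_rel (ptensor (m + m') n - (ptensor m n + ptensor m' n))
| tensor_relDr m n n' :
    tensor_rel (ptensor m (n + n') - (ptensor m n + ptensor m n'))
| tensor_relA m a n :
    tensor_rel (ptensor (ra m a) n - ptensor m (la a n)).

Definition tensor := quotient (span_subgroup tensor_rel).

HB.instance Definition _ := GRing.Zmodule.on tensor.

Definition tens (m : M) (n : N) : tensor := qclass _ (ptensor m n).

Definition balanced (G : zmodType) (f : M -> N -> G) :=
  [/\ forall m m' n, f (m + m') n = f m n + f m' n,
      forall m n n', f m (n + n') = f m n + f m n' &
      forall m a n, f (ra m a) n = f m (la a n)].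

Lemma tens_balanced : balanced tens.
Proof.
split=> *; rewrite /tens -?[RHS](raddfD (qclass _)); apply/qclassP;
  by apply: span_gen; constructor.
Qed.

Lemma tensor_ind (P : set tensor) (t : tensor) : subgroup P ->
  (forall m n, P (tens m n)) -> P t.
Proof.
move=> gP Pt; rewrite -[t]qclass_repr.
set Q : set {freeg (M * N)%type / int} := [set s | P (qclass _ s)].
have gQ : subgroup Q.
  split; rewrite /Q /mkset; first by rewrite raddf0; exact: (proj1 gP).
  by move=> x y Px Py; rewrite raddfB; exact: (proj2 gP).
have Qn (n : nat) x : Q << n%:R *g x >>.
  rewrite -freegU_muln; elim: n => [|n IHn].
    by rewrite mulr0n; exact: (proj1 gQ).
  by rewrite mulrS; apply: (subgroupD gQ) => //; rewrite [x]surjective_pairing; exact: Pt.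
suff : Q (repr t) by [].
rewrite -[repr t]freeg_sumE; elim/big_ind: _ => [|x y|x _].
- exact: (proj1 gQ).
- exact: (subgroupD gQ).
case: (coeff x _) => n; first by rewrite -[Posz n]natz; exact: Qn.
by rewrite NegzE -freegUN; apply: (subgroupN gQ); rewrite -[Posz _]natz; exact: Qn.
Qed.

Section Lift.
Variables (G : zmodType) (f : M -> N -> G).

(* The additive map induced by f, provided f is balanced. *)
Definition tensor_lift (t : tensor) : G :=
  fglift (fun mn : M * N => f mn.1 mn.2 : zmodule G) (repr t).

Hypothesis fbal : balanced f.

Let F := fglift (fun mn : M * N => f mn.1 mn.2 : zmodule G).

Let FB : {morph F : s t / s - t}.
Proof. exact: lift_is_additive. Qed.

Let F0 : F 0 = 0. Proof. by rewrite -(subrr 0) FB subrr. Qed.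

Let FD s t : F (s + t) = F s + F t.
Proof. by rewrite -{1}[t]opprK FB -[- t]sub0r FB F0 sub0r opprK. Qed.

Let Fp m n : F (ptensor m n) = f m n.
Proof. by rewrite /F liftU scale1r. Qed.

Let F_rel s : span tensor_rel s -> F s = 0.
Proof.
have [fDl fDr fA] := fbal.
elim=> {s} [s||s t _ Fs _ Ft]; last by rewrite FB Fs Ft subrr.
  by case=> *; rewrite FB ?FD !Fp ?fDl ?fDr ?fA subrr.
exact: F0.
Qed.

Let F_qclass s : tensor_lift (qclass _ s) = F s.
Proof.
apply/subr0_eq; rewrite -[LHS]FB; apply: F_rel; exact: repr_qclass.
Qed.

Lemma tensor_lift_tens m n : tensor_lift (tens m n) = f m n.
Proof. by rewrite F_qclass Fp. Qed.

Lemma tensor_liftB : {morph tensor_lift : s t / s - t}.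
Proof.
move=> s t; rewrite -[s]qclass_repr -[t]qclass_repr.
by rewrite -[X in tensor_lift X](raddfB (qclass _)) !F_qclass FB.
Qed.

Lemma tensor_liftD : {morph tensor_lift : s t / s + t}.
Proof.
move=> s t; rewrite -[s]qclass_repr -[t]qclass_repr.
by rewrite -[X in tensor_lift X](raddfD (qclass _)) !F_qclass FD.
Qed.

End Lift.

End Tensor.

Section DirectSum.
Variables (V : zmodType) (I : choiceType) (M : I -> set V).

Definition decomposition (v : V) (f : I -> V) :=
  [/\ forall i, M i (f i), finite_set [set i | f i != 0] &
      v = \sum_(i \in [set: I]) f i].

Definition direct_sum := forall v, exists! f, decomposition v f.

(* The components of v; meaningful only when direct_sum holds. *)
Definition component (v : V) : I -> V :=
  if pselect (exists f, decomposition v f) is left e then projT1 (cid e)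
  else fun=> 0.

Lemma componentP v f : direct_sum -> decomposition v f -> component v = f.
Proof.
move=> /(_ v)[g [_ guniq]] dec_f; rewrite /component.
case: pselect => [e|]; last by case; exists f.
case: (cid e) => h dec_h /=.
by rewrite -(guniq _ dec_h) -(guniq _ dec_f).
Qed.

Lemma component_decomposition v :
  direct_sum -> decomposition v (component v).
Proof. by move=> dM; have [f [df _]] := dM v; rewrite (componentP dM df). Qed.

Lemma component_ind (S : set V) v : direct_sum -> subgroup S ->
  (forall i, S (component v i)) -> S v.
Proof.
move=> dM gS Sv; have [_ _ ->] := component_decomposition v dM.
by elim/big_ind: _ => // [|x y]; [exact: (proj1 gS) | exact: subgroupD].
Qed.

Hypothesis gM : forall i, subgroup (M i).

Lemma componentB v w : direct_sum ->
  component (v - w) = (fun i => component v i - component w i).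
Proof.
move=> dM; apply: componentP => //.
have [Mv fv ev] := component_decomposition v dM.
have [Mw fw ew] := component_decomposition w dM.
have fU : finite_set ([set i | component v i != 0]
                      `|` [set i | component w i != 0]) by rewrite finite_setU.
split.
- by move=> i; apply: (proj2 (gM i)).
- apply: sub_finite_set fU => i /=; have [->|] := eqVneq (component v i) 0.
    by rewrite sub0r oppr_eq0; right.
  by left.
- rewrite [in LHS]ev [in LHS]ew.
  set D := _ `|` _ in fU.
  have widen (f : I -> V) : (forall i, f i != 0 -> D i) ->
      \sum_(i \in [set: I]) f i = \sum_(i \in D) f i.
    move=> fD; apply/esym/fsbig_widen => // i [_ nDi] /=.
    by apply: contrapT => /eqP /fD.
  rewrite (widen (component v)); last by move=> i; left.
  rewrite (widen (component w)); last by move=> i; right.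
  rewrite widen; last first.
    move=> i; have [->|] := eqVneq (component v i) 0; last by left.
    by rewrite sub0r oppr_eq0; right.
  rewrite !fsbig_finite//=.
  by rewrite big_split/= sumrN.
Qed.

Lemma component_homog (i : I) v : direct_sum -> M i v ->
  component v = (fun j => if j == i then v else 0).
Proof.
move=> dM Mv; apply: componentP => //; split.
- by move=> j; case: eqP => [->//|_]; exact: (proj1 (gM j)).
- apply: (@sub_finite_set _ _ [set i]) => [j /=|]; last exact: finite_set1.
  by case: (eqVneq j i) => // _; rewrite eqxx.
- rewrite -(fsbig_widen [set i] [set: I]) ?fsbig_set1 ?eqxx//.
  by move=> j /= [_ /eqP/negPf ->].
Qed.

End DirectSum.

Record gradedRing (k : comPzRingType) := GradedRing {
  gring :> kalg k;
  homog : int -> set gring;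
  homogB : forall p, subgroup (homog p);
  homogZ : forall p c x, homog p x -> homog p (kin gring c * x);
  homog1 : homog 0 1;
  homogM : forall p q x y, homog p x -> homog q y -> homog (p + q) (x * y);
  homog_sum : direct_sum homog
}.

Section GradedRing.
Variables (k : comPzRingType) (U : gradedRing k).

Definition deg_le (m : int) : set U :=
  span (\bigcup_(p in [set p | p <= m]) homog p).

(* The left ideal U . U_{<= m}. *)
Definition left_ideal_le (m : int) : set U :=
  span [set x * y | x in setT & y in deg_le m].

End GradedRing.

(* Almost-canonically seminormed rings: NL n is N_L^n U, and N_L^n U_p is
   NL n `&` homog p. *)
Record acsRing (k : comPzRingType) := AcsRing {
  acs_gring :> gradedRing k;
  NL : int -> set acs_gring;
  NL_B : forall n, subgroup (NL n);
  NL_Z : forall n c x, NL n x -> NL n (kin acs_gring c * x);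
  NL_graded : forall n x p, NL n x -> NL n (component (@homog k acs_gring) x p);
  NL_decr : forall m n, n <= m -> NL m `<=` NL n;
  NL_left : forall n, left_ideal_le (- n) `<=` NL n;
  NL_almost : forall n m p, n <= m ->
    NL n `&` homog p =
    [set y + z | y in left_ideal_le (- n) `&` homog p & z in NL m `&` homog p];
  NL_mulr : forall n p q x y,
    NL n x -> homog p x -> homog q y -> NL (n - q) (x * y);
  NL_mull : forall n p q x y,
    homog p x -> NL n y -> homog q y -> NL n (x * y)
}.

Section ZhuAlgebra.
Variables (k : comPzRingType) (U : acsRing k).

(* N_R^n U, the sum over p of the N_R^n U_p = N_L^(n-p) U_p. *)
Definition NR (n : int) : set U :=
  [set x | forall p, NL (n - p) (component (@homog k U) x p)].

Fact NR_B n : subgroup (NR n).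
Proof.
split=> [p|x y Nx Ny p].
  rewrite (component_homog (homogB U) (@homog_sum k U) (i := p)).
    by rewrite eqxx; exact: (proj1 (NL_B U _)).
  exact: (proj1 (homogB U _)).
rewrite (componentB (homogB U)); last exact: homog_sum.
exact: (proj2 (NL_B U _)).
Qed.

(* The left module U / N_L^1 U and the right module U / N_R^1 U. *)
Definition L0 := quotient (NL_B U 1).
Definition R0 := quotient (NR_B 1).

HB.instance Definition _ := GRing.Zmodule.on L0.
HB.instance Definition _ := GRing.Zmodule.on R0.

Definition piL (x : U) : L0 := qclass _ x.
Definition piR (x : U) : R0 := qclass _ x.

Definition L0_homog (p : int) : set L0 := [set piL x | x in homog p].
Definition R0_homog (p : int) : set R0 := [set piR x | x in homog p].

(* The degree 0 subring of U. *)
Definition in_degree0 : pred U := fun x => `[< homog 0 x >].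

Fact in_degree0_closed : subring_closed in_degree0.
Proof.
split; first by apply/asboolP; exact: homog1.
- by move=> x y /asboolP Ux /asboolP Uy; apply/asboolP; exact: (proj2 (homogB U _)).
- move=> x y /asboolP Ux /asboolP Uy; apply/asboolP.
  by rewrite -[0]addr0; exact: homogM.
Qed.

Definition degree0 : Type := {x : U | in_degree0 x}.

HB.instance Definition _ := SubChoice.on degree0.
HB.instance Definition _ :=
  GRing.SubChoice_isSubPzRing.Build U in_degree0 degree0 in_degree0_closed.

Definition incl0 : {rmorphism degree0 -> U} := \val.

Lemma incl0_inj : injective incl0. Proof. exact: val_inj. Qed.

Lemma degree0P (x : degree0) : homog 0 (incl0 x).
Proof. by apply/asboolP; exact: (valP x). Qed.

Fact zhu_ideal_subgroup : subgroup [set x : degree0 | NL 1 (incl0 x)].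
Proof.
by split=> [|x y]; [exact: (proj1 (NL_B U 1)) | exact: (proj2 (NL_B U 1))].
Qed.

Definition zhu_carrier := quotient zhu_ideal_subgroup.

HB.instance Definition _ := GRing.Zmodule.on zhu_carrier.

Definition piA (x : degree0) : zhu_carrier := qclass _ x.

Definition zhu_one : zhu_carrier := piA 1.
Definition zhu_mul (a b : zhu_carrier) : zhu_carrier := piA (repr a * repr b).

Lemma piA_repr a : piA (repr a) = a. Proof. exact: qclass_repr. Qed.

Lemma piAP x y : piA x = piA y <-> NL 1 (incl0 x - incl0 y).
Proof. by rewrite -raddfB; exact: qclassP. Qed.

Lemma piAM x y : piA (x * y) = zhu_mul (piA x) (piA y).
Proof.
apply/esym/piAP; rewrite !rmorphM /=.
set x' := repr (piA x); set y' := repr (piA y).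
have Nx : NL 1 (val x' - incl0 x) by apply/piAP; rewrite piA_repr.
have Ny : NL 1 (incl0 y' - incl0 y) by apply/piAP; rewrite piA_repr.
have -> : incl0 x' * incl0 y' - incl0 x * incl0 y =
  incl0 x' * (incl0 y' - incl0 y) + (incl0 x' - incl0 x) * incl0 y.
  by rewrite mulrBr mulrBl addrA subrK.
have H0 (z w : degree0) : homog 0 (incl0 z - incl0 w).
  by apply: (proj2 (homogB U _)); exact: degree0P.
apply: subgroupD; first exact: (NL_B U).
  by apply: (NL_mull (p := 0) (q := 0)) => //; exact: degree0P.
rewrite -[1](subr0 1).
by apply: (NL_mulr (p := 0) (q := 0)) => //; exact: degree0P.
Qed.

Let piAD x y : piA (x + y) = piA x + piA y. Proof. exact: (raddfD (qclass _)). Qed.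

Fact zhu_mulA : associative zhu_mul.
Proof.
by move=> a b c; rewrite -[a]piA_repr -[b]piA_repr -[c]piA_repr -!piAM mulrA.
Qed.
Fact zhu_mul1 : left_id zhu_one zhu_mul.
Proof. by move=> a; rewrite -[a]piA_repr -piAM mul1r. Qed.
Fact zhu_mulr1 : right_id zhu_one zhu_mul.
Proof. by move=> a; rewrite -[a]piA_repr -piAM mulr1. Qed.
Fact zhu_mulDl : left_distributive zhu_mul +%R.
Proof.
move=> a b c; rewrite -[a]piA_repr -[b]piA_repr -[c]piA_repr.
by rewrite -piAD -!piAM -piAD mulrDl.
Qed.
Fact zhu_mulDr : right_distributive zhu_mul +%R.
Proof.
move=> a b c; rewrite -[a]piA_repr -[b]piA_repr -[c]piA_repr.
by rewrite -piAD -!piAM -piAD mulrDr.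
Qed.

HB.instance Definition _ := GRing.Zmodule_isPzRing.Build zhu_carrier
  zhu_mulA zhu_mul1 zhu_mulr1 zhu_mulDl zhu_mulDr.

Fact kin_degree0 (c : k) : in_degree0 (kin U c).
Proof. by apply/asboolP; rewrite -[kin U c]mulr1; apply/homogZ/homog1. Qed.

Definition zhu_kin (c : k) : zhu_carrier := piA (Sub (kin U c) (kin_degree0 c)).

Fact zhu_kin_zmod : zmod_morphism zhu_kin.
Proof.
move=> c d; rewrite /zhu_kin -[RHS](raddfB (qclass zhu_ideal_subgroup)).
by congr (piA _); apply: val_inj; exact: (raddfB (kin U)).
Qed.
Fact zhu_kin_monoid : monoid_morphism zhu_kin.
Proof.
split=> [|c d].
  by congr (piA _); apply: val_inj; exact: (rmorph1 (kin U)).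
rewrite -[RHS]piAM; congr (piA _); apply: val_inj.
exact: (rmorphM (kin U)).
Qed.

HB.instance Definition _ :=
  GRing.isZmodMorphism.Build k zhu_carrier zhu_kin zhu_kin_zmod.
HB.instance Definition _ :=
  GRing.isMonoidMorphism.Build k zhu_carrier zhu_kin zhu_kin_monoid.

Fact zhu_kin_central (c : k) (a : zhu_carrier) : zhu_kin c * a = a * zhu_kin c.
Proof.
rewrite -[a]piA_repr /zhu_kin -[LHS]piAM -[RHS]piAM; congr (piA _).
by apply: val_inj; exact: kin_central.
Qed.

(* The zeroth Zhu algebra A_0 = U_0 / N_L^1 U_0. *)
Definition zhu : kalg k := @Kalg k zhu_carrier zhu_kin zhu_kin_central.

End ZhuAlgebra.

Arguments incl0 {k U}.

Section ModeTransition.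
Variables (k : comPzRingType) (U : acsRing k).

Definition L0_ract (u : L0 U) (a : zhu U) : L0 U :=
  piL (repr u * incl0 (repr a)).

Definition R0_lact (a : zhu U) (v : R0 U) : R0 U :=
  piR (incl0 (repr a) * repr v).

Let dU := @homog_sum k U.

Lemma NL_mulr_all n q x y : NL n x -> homog q y -> NL (n - q) (x * y : U).
Proof.
move=> Nx Uy.
apply: (component_ind (M := @homog k U) (S := [set z | NL (n - q) (z * y)])
  (v := x)) => //.
  split; rewrite /mkset; first by rewrite mul0r; exact: (proj1 (NL_B U _)).
  by move=> z w Nz Nw; rewrite mulrBl; exact: (proj2 (NL_B U _)).
move=> p; have [Mx _ _] := component_decomposition x dU.
by apply: (NL_mulr (p := p)) => //; exact: NL_graded.
Qed.

Lemma NL_mull_all n x y : NL n y -> NL n (x * y : U).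
Proof.
move=> Ny.
apply: (component_ind (M := @homog k U) (S := [set z | NL n (z * y)])
  (v := x)) => //.
  split; rewrite /mkset; first by rewrite mul0r; exact: (proj1 (NL_B U _)).
  by move=> z w Nz Nw; rewrite mulrBl; exact: (proj2 (NL_B U _)).
move=> p; have [Mx _ _] := component_decomposition x dU.
apply: (component_ind (M := @homog k U)
  (S := [set z | NL n (component (@homog k U) x p * z)]) (v := y)) => //.
  split; rewrite /mkset; first by rewrite mulr0; exact: (proj1 (NL_B U _)).
  by move=> z w Nz Nw; rewrite mulrBr; exact: (proj2 (NL_B U _)).
move=> q; have [My _ _] := component_decomposition y dU.
by apply: (NL_mull (p := p) (q := q)) => //; exact: NL_graded.
Qed.

Lemma homog_NR n p x : homog p x -> NL (n - p) x -> NR n (x : U).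
Proof.
move=> Ux Nx q; rewrite (component_homog (homogB U) dU Ux).
by case: eqP => [->//|_]; exact: (proj1 (NL_B U _)).
Qed.

Lemma NR_mull0 n x y : homog 0 x -> NR n y -> NR n (x * y : U).
Proof.
move=> Ux Ny.
apply: (component_ind (M := @homog k U) (S := [set z | NR n (x * z)])
  (v := y)) => //.
  split; rewrite /mkset; first by rewrite mulr0; exact: (proj1 (NR_B U _)).
  by move=> z w Nz Nw; rewrite mulrBr; exact: (proj2 (NR_B U _)).
move=> p; have [My _ _] := component_decomposition y dU.
apply: (homog_NR (p := p)); first by have := homogM Ux (My p); rewrite add0r.
by apply: NL_mull_all; exact: Ny.
Qed.

Lemma NR_mulr n x y : homog 0 x -> NL n x -> NR n (x * y : U).
Proof.
move=> Ux Nx.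
apply: (component_ind (M := @homog k U) (S := [set z | NR n (x * z)])
  (v := y)) => //.
  split; rewrite /mkset; first by rewrite mulr0; exact: (proj1 (NR_B U _)).
  by move=> z w Nz Nw; rewrite mulrBr; exact: (proj2 (NR_B U _)).
move=> p; have [My _ _] := component_decomposition y dU.
apply: (homog_NR (p := p)); first by have := homogM Ux (My p); rewrite add0r.
exact: NL_mulr_all.
Qed.

Lemma piLP x y : piL x = piL y <-> NL 1 (x - y : U).
Proof. exact: qclassP. Qed.

Lemma piRP x y : piR x = piR y <-> NR 1 (x - y : U).
Proof. exact: qclassP. Qed.

Lemma piL_repr (u : L0 U) : piL (repr u) = u. Proof. exact: qclass_repr. Qed.
Lemma piR_repr (v : R0 U) : piR (repr v) = v. Proof. exact: qclass_repr. Qed.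

Lemma piLD (x y : U) : piL (x + y) = piL x + piL y.
Proof. exact: (raddfD (qclass _)). Qed.
Lemma piRD (x y : U) : piR (x + y) = piR x + piR y.
Proof. exact: (raddfD (qclass _)). Qed.
Lemma piAD (x y : degree0 U) : piA (x + y) = piA x + piA y.
Proof. exact: (raddfD (qclass _)). Qed.

Lemma piAB (x y : degree0 U) : piA (x - y) = piA x - piA y.
Proof. exact: (raddfB (qclass _)). Qed.

Lemma L0_ract_pi (x : U) (a : degree0 U) :
  L0_ract (piL x) (piA a) = piL (x * incl0 a).
Proof.
apply/piLP; set x' := repr _; set a' := repr _.
have Nx : NL 1 (x' - x) by apply/piLP; rewrite piL_repr.
have Na : NL 1 (incl0 a' - incl0 a) by apply/piAP; rewrite piA_repr.
have -> : x' * incl0 a' - x * incl0 a =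
    x' * (incl0 a' - incl0 a) + (x' - x) * incl0 a.
  by rewrite mulrBr mulrBl addrA subrK.
apply: subgroupD; [exact: (NL_B U)|exact: NL_mull_all|].
by rewrite -[1]subr0; apply: NL_mulr_all => //; exact: degree0P.
Qed.

Lemma R0_lact_pi (a : degree0 U) (x : U) :
  R0_lact (piA a) (piR x) = piR (incl0 a * x).
Proof.
apply/piRP; set x' := repr (piR x); set a' := repr (piA a).
have Nx : NR 1 (x' - x) by apply/piRP; rewrite piR_repr.
have Na : NL 1 (incl0 a' - incl0 a) by apply/piAP; rewrite piA_repr.
have -> : incl0 a' * x' - incl0 a * x =
    incl0 a' * (x' - x) + (incl0 a' - incl0 a) * x.
  by rewrite mulrBr mulrBl addrA subrK.
apply: (subgroupD (NR_B U 1)); first by apply: NR_mull0 => //; exact: degree0P.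
by apply: NR_mulr => //; apply: (proj2 (homogB U 0)); exact: degree0P.
Qed.

Fact component0P (x : U) : in_degree0 (component (@homog k U) x 0).
Proof.
by apply/asboolP; have [] := component_decomposition x (@homog_sum k U).
Qed.

Definition degree0_part (x : U) : degree0 U := Sub _ (component0P x).

(* The additive extension to all classes of the rule on homogeneous elements
   given by the lemmas pairing_homog and pairing_homog0. *)
Definition pairing (v : R0 U) (u : L0 U) : zhu U :=
  piA (degree0_part (repr v * repr u)).

Lemma degree0_partB x y :
  degree0_part (x - y) = degree0_part x - degree0_part y.
Proof.
apply: incl0_inj; rewrite raddfB.
transitivity (component (@homog k U) (x - y) 0) => //.
by rewrite (componentB (homogB U) _ _ dU).
Qed.

Lemma degree0_part_homog p x : homog p x ->
  incl0 (degree0_part x) = if p == 0 then x else 0.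
Proof.
move=> Ux; transitivity (component (@homog k U) x 0) => //.
by rewrite (component_homog (homogB U) dU Ux) eq_sym.
Qed.

Let degree0_part0 : degree0_part 0 = 0.
Proof. by rewrite -(subrr 0) degree0_partB subrr. Qed.

Lemma degree0_part_NL x : NL 1 x -> piA (degree0_part x) = 0.
Proof.
move=> Nx; rewrite -[RHS](raddf0 (qclass _)); apply/piAP.
by rewrite -raddfB subr0; exact: NL_graded.
Qed.

Let S0 : subgroup [set z : U | piA (degree0_part z) = 0].
Proof.
have p0 : piA 0 = 0 :> zhu U by exact: (raddf0 (qclass _)).
split=> [|z w zE wE] /=; first by rewrite degree0_part0.
by rewrite degree0_partB piAB zE wE subrr.
Qed.

Lemma degree0_part_NR x y : NR 1 x -> piA (degree0_part (x * y)) = 0.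
Proof.
move=> Nx.
apply: (component_ind (M := @homog k U)
  (S := [set z | piA (degree0_part (z * y)) = 0]) (v := x)) => //.
  split; rewrite /mkset; first by rewrite mul0r; exact: (proj1 S0).
  by move=> z w Nz Nw; rewrite mulrBl; exact: (proj2 S0).
move=> p; have [Mx _ _] := component_decomposition x dU.
apply: (component_ind (M := @homog k U)
  (S := [set z | piA (degree0_part (component (@homog k U) x p * z)) = 0])
  (v := y)) => //.
  split; rewrite /mkset; first by rewrite mulr0; exact: (proj1 S0).
  by move=> z w Nz Nw; rewrite mulrBr; exact: (proj2 S0).
move=> q; have [My _ _] := component_decomposition y dU.
rewrite /=; set xp := component _ x p; set yq := component _ y q.
have Mxy : homog (p + q) (xp * yq) by exact: homogM.
have [pq|pq] := eqVneq (p + q) 0.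
  apply: degree0_part_NL; suff: NL (1 - p - q) (xp * yq) by rewrite -addrA -opprD pq subr0.
  by apply: NL_mulr_all => //; exact: Nx.
suff -> : degree0_part (xp * yq) = 0 by exact: (raddf0 (qclass _)).
apply: incl0_inj; rewrite (degree0_part_homog Mxy).
by rewrite (negPf pq).
Qed.

Lemma pairing_pi x y : pairing (piR x) (piL y) = piA (degree0_part (x * y)).
Proof.
rewrite /pairing; set x' := repr _; set y' := repr _.
have Nx : NR 1 (x' - x) by apply/piRP; rewrite piR_repr.
have Ny : NL 1 (y' - y) by apply/piLP; rewrite piL_repr.
apply/subr0_eq; rewrite -[LHS](raddfB (qclass _)) -degree0_partB.
have -> : x' * y' - x * y = x' * (y' - y) + (x' - x) * y.
  by rewrite mulrBr mulrBl addrA subrK.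
apply: (subgroupD S0); first by apply/degree0_part_NL/NL_mull_all.
exact: degree0_part_NR.
Qed.

Lemma pairing_homog p q x y (z : degree0 U) : homog p x -> homog q y ->
  p + q = 0 -> incl0 z = x * y -> pairing (piR x) (piL y) = piA z.
Proof.
move=> Ux Uy pq zE; rewrite pairing_pi; congr piA; apply: incl0_inj.
rewrite zE.
by rewrite (degree0_part_homog (homogM Ux Uy)) pq eqxx.
Qed.

Lemma pairing_homog0 p q x y : homog p x -> homog q y ->
  p + q != 0 -> pairing (piR x) (piL y) = 0.
Proof.
move=> Ux Uy pq; rewrite pairing_pi; suff -> : degree0_part (x * y) = 0.
  exact: (raddf0 (qclass _)).
apply: incl0_inj; rewrite (degree0_part_homog (homogM Ux Uy)).
by rewrite (negPf pq).
Qed.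

Lemma degree0_part_mulr x (a : degree0 U) :
  degree0_part (x * incl0 a) = degree0_part x * a.
Proof.
apply: (component_ind (M := @homog k U)
  (S := [set z | degree0_part (z * incl0 a) = degree0_part z * a]) (v := x)).
- exact: dU.
- split=> [|z w zE wE] /=; first by rewrite !(mul0r, degree0_part0).
  by rewrite mulrBl !degree0_partB zE wE mulrBl.
move=> p /=; have [Mx _ _] := component_decomposition x dU.
set xp := component _ x p; have Uxp : homog p xp by exact: Mx.
have Uxa : homog p (xp * incl0 a).
  by rewrite -[p]addr0; apply: homogM => //; exact: degree0P.
apply: incl0_inj; rewrite rmorphM.
rewrite (degree0_part_homog Uxa) (degree0_part_homog Uxp).
by case: ifP => // _; rewrite mul0r.
Qed.

Lemma degree0_part_mull x (a : degree0 U) :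
  degree0_part (incl0 a * x) = a * degree0_part x.
Proof.
apply: (component_ind (M := @homog k U)
  (S := [set z | degree0_part (incl0 a * z) = a * degree0_part z]) (v := x)).
- exact: dU.
- split=> [|z w zE wE] /=; first by rewrite !(mulr0, degree0_part0).
  by rewrite mulrBr !degree0_partB zE wE mulrBr.
move=> p /=; have [Mx _ _] := component_decomposition x dU.
set xp := component _ x p; have Uxp : homog p xp by exact: Mx.
have Uxa : homog p (incl0 a * xp).
  by rewrite -[p]add0r; apply: homogM => //; exact: degree0P.
apply: incl0_inj; rewrite rmorphM.
rewrite (degree0_part_homog Uxa) (degree0_part_homog Uxp).
by case: ifP => // _; rewrite mulr0.
Qed.

Let degree0_partD x y :
  degree0_part (x + y) = degree0_part x + degree0_part y.
Proof.
by rewrite -{1}[y]opprK degree0_partB -[- y]sub0r degree0_partB degree0_part0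
  sub0r opprK.
Qed.

Lemma pairingDl v w u : pairing (v + w) u = pairing v u + pairing w u.
Proof.
rewrite -[v]piR_repr -[w]piR_repr -[u]piL_repr -piRD !pairing_pi.
by rewrite mulrDl degree0_partD piAD.
Qed.

Lemma pairingDr v u w : pairing v (u + w) = pairing v u + pairing v w.
Proof.
rewrite -[v]piR_repr -[w]piL_repr -[u]piL_repr -piLD !pairing_pi.
by rewrite mulrDr degree0_partD piAD.
Qed.

Lemma pairing_ract v u a : pairing v (L0_ract u a) = pairing v u * a.
Proof.
rewrite -[v]piR_repr -[u]piL_repr -[a]piA_repr L0_ract_pi !pairing_pi.
by rewrite mulrA degree0_part_mulr -[RHS]piAM.
Qed.

Lemma pairing_lact a v u : pairing (R0_lact a v) u = a * pairing v u.
Proof.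
rewrite -[v]piR_repr -[u]piL_repr -[a]piA_repr R0_lact_pi !pairing_pi.
by rewrite -mulrA degree0_part_mull -[RHS]piAM.
Qed.

Lemma R0_lactDl a b v : R0_lact (a + b) v = R0_lact a v + R0_lact b v.
Proof.
rewrite -[v]piR_repr -[a]piA_repr -[b]piA_repr.
by rewrite -[X in R0_lact X]piAD !R0_lact_pi rmorphD mulrDl piRD.
Qed.

Lemma R0_lactDr a v w : R0_lact a (v + w) = R0_lact a v + R0_lact a w.
Proof.
rewrite -[v]piR_repr -[w]piR_repr -[a]piA_repr.
by rewrite -piRD !R0_lact_pi mulrDr piRD.
Qed.

Lemma R0_lactA a b v : R0_lact (a * b) v = R0_lact a (R0_lact b v).
Proof.
rewrite -[v]piR_repr -[a]piA_repr -[b]piA_repr.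
by rewrite -[X in R0_lact X]piAM !R0_lact_pi rmorphM mulrA.
Qed.

(* The mode transition algebra, as an additive group. *)
Definition mta := tensor L0_ract R0_lact.

HB.instance Definition _ := GRing.Zmodule.on mta.

Definition mta_tens (u : L0 U) (v : R0 U) : mta := tens L0_ract R0_lact u v.

(* The summand L^0_p (x) R^0_q: the gradings of L^0 and R^0 are by A_0-submodules,
   so the tensor product of the components embeds in the full one. *)
Definition mta_homog (p q : int) : set mta :=
  span [set mta_tens u v | u in L0_homog p & v in R0_homog q].

(* (u (x) v) * (u' (x) v') = u (x) (pairing v u') v', see star_tens, starBl and
   starBr. *)
Definition star (s t : mta) : mta :=
  tensor_lift (fun u v =>
    tensor_lift (fun u' v' => mta_tens u (R0_lact (pairing v u') v')) t) s.

Let star_inner_balanced u v : balanced (@L0_ract) (@R0_lact)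
  (fun u' v' => mta_tens u (R0_lact (pairing v u') v')).
Proof.
have [tDl tDr tA] := tens_balanced L0_ract R0_lact.
split=> *; rewrite /mta_tens.
- by rewrite pairingDr R0_lactDl tDr.
- by rewrite R0_lactDr tDr.
- by rewrite pairing_ract R0_lactA.
Qed.

Let star_inner (u : L0 U) (v : R0 U) (t : mta) : mta :=
  tensor_lift (fun u' v' => mta_tens u (R0_lact (pairing v u') v')) t.

Let star_innerB u v : {morph star_inner u v : s t / s - t}.
Proof. exact: (tensor_liftB (star_inner_balanced u v)). Qed.

Let star_inner_tens u v u' v' :
  star_inner u v (mta_tens u' v') = mta_tens u (R0_lact (pairing v u') v').
Proof. exact: (tensor_lift_tens (star_inner_balanced u v)). Qed.

Let eq_subgroup (f g : mta -> mta) : {morph f : s t / s - t} ->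
  {morph g : s t / s - t} -> subgroup [set t | f t = g t].
Proof.
move=> fB gB; split=> [|s t] /=; first by rewrite -(subrr 0) fB gB !subrr.
by rewrite fB gB => -> ->.
Qed.

Let add_morphB (f g : mta -> mta) : {morph f : s t / s - t} ->
  {morph g : s t / s - t} -> {morph (fun t => f t + g t) : s t / s - t}.
Proof. by move=> fB gB s t; rewrite /= fB gB opprD addrACA. Qed.

Let star_outer_balanced (t : mta) :
  balanced L0_ract R0_lact (fun u v => star_inner u v t).
Proof.
have [tDl tDr tA] := tens_balanced L0_ract R0_lact.
split=> [u w v|u v w|u a v].
- apply: (tensor_ind (P := [set t | star_inner (u + w) v t =
    star_inner u v t + star_inner w v t])) => [|u' v'].
    by apply: eq_subgroup; [|apply: add_morphB]; exact: star_innerB.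
  by rewrite /mkset -/(mta_tens u' v') !star_inner_tens /mta_tens tDl.
- apply: (tensor_ind (P := [set t | star_inner u (v + w) t =
    star_inner u v t + star_inner u w t])) => [|u' v'].
    by apply: eq_subgroup; [|apply: add_morphB]; exact: star_innerB.
  rewrite /mkset -/(mta_tens u' v') !star_inner_tens /mta_tens.
  by rewrite pairingDl R0_lactDl tDr.
- apply: (tensor_ind (P := [set t | star_inner (L0_ract u a) v t =
    star_inner u (R0_lact a v) t])) => [|u' v'].
    by apply: eq_subgroup; exact: star_innerB.
  rewrite /mkset -/(mta_tens u' v') !star_inner_tens /mta_tens.
  by rewrite pairing_lact R0_lactA tA.
Qed.

Lemma star_tens u v u' v' :
  star (mta_tens u v) (mta_tens u' v') =
  mta_tens u (R0_lact (pairing v u') v').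
Proof.
rewrite -star_inner_tens.
exact: (tensor_lift_tens (star_outer_balanced (mta_tens u' v'))).
Qed.

Lemma starBl s s' t : star (s - s') t = star s t - star s' t.
Proof. exact: (tensor_liftB (star_outer_balanced t)). Qed.

Lemma starBr s t t' : star s (t - t') = star s t - star s t'.
Proof.
apply: (tensor_ind (P := [set s | star s (t - t') = star s t - star s t'])).
  split=> [|x y] /=.
    have star0 z : star 0 z = 0 by have := starBl 0 0 z; rewrite !subrr.
    by rewrite !star0 subrr.
  by rewrite !starBl => -> ->; rewrite !opprB addrACA [RHS]addrACA [in RHS](addrC (- _)).
move=> u v; have E z : star (mta_tens u v) z = star_inner u v z.
  exact: (tensor_lift_tens (star_outer_balanced z)).
by rewrite /mkset -/(mta_tens u v) !E star_innerB.
Qed.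

End ModeTransition.

Definition strong_identity (k : comPzRingType) (U : acsRing k) :=
  exists one : nat -> mta U,
    (forall n : nat, mta_homog n%:Z (- n%:Z) (one n)) /\
    (forall (n m : nat) (a : mta U), mta_homog n%:Z (- m%:Z) a ->
       star (one n) a = a /\ star a (one m) = a).

(* (S|T)-bimodules; the two induced actions of k agree. *)
Record bimodule (k : comPzRingType) (S T : kalg k) := Bimodule {
  bimod :> lmodType S;
  ract : bimod -> T -> bimod;
  ractDl : forall v w a, ract (v + w) a = ract v a + ract w a;
  ractDr : forall w a b, ract w (a + b) = ract w a + ract w b;
  ractA : forall w a b, ract w (a * b) = ract (ract w a) b;
  ract1 : forall w, ract w 1 = w;
  ract_scale : forall x w a, ract (x *: w) a = x *: ract w a;
  ract_kin : forall c w, ract w (kin T c) = kin S c *: w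
}.

Record posGradedBimodule (k : comPzRingType) (U : gradedRing k) (R : kalg k) :=
  PosGradedBimodule {
  pgb :> bimodule U R;
  whomog : int -> set pgb;
  whomogB : forall n, subgroup (whomog n);
  whomog_ract : forall n w a, whomog n w -> whomog n (ract w a);
  whomog_scale : forall p n (x : U) w,
    homog p x -> whomog n w -> whomog (p + n) (x *: w);
  whomog_sum : direct_sum whomog;
  whomog_bounded : exists N : int, forall n, n < N -> whomog n `<=` [set 0]
}.

Section Rational.
Variables (k : comPzRingType) (U : gradedRing k) (R : kalg k).
Variable W : posGradedBimodule U R.
Implicit Types S P : set W.

Definition graded_subbimodule S :=
  [/\ subgroup S,
      forall (x : U) w, S w -> S (x *: w),
      forall w (a : R), S w -> S (ract w a) &
      forall w n, S w -> S (component (@whomog k U R W) w n)].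

Definition graded_simple S :=
  (exists2 w, S w & w <> 0) /\
  (forall S', graded_subbimodule S' -> S' `<=` S -> S' = [set 0] \/ S' = S).

Definition finitely_generated P :=
  exists (m : nat) (g : 'I_m -> W), (forall i, P (g i)) /\
    (forall w, P w -> exists c : 'I_m -> R, w = \sum_(i < m) ract (g i) (c i)).

(* The restriction of f to the right R-submodule P is R-linear; a right
   R-module is a left module over the converse ring R^c. *)
Definition right_linear_on P (M : lmodType R^c) (f : W -> M) :=
  (forall v w, P v -> P w -> f (v + w) = f v + f w) /\
  (forall w (a : R), P w -> f (ract w a) = (a : R^c) *: f w).

(* The lifting property; morphisms out of P are restrictions of functions on
   W. *)
Definition projective P :=
  forall (M N : lmodType R^c) (g : {linear M -> N}),
    (forall y, exists x, g x = y) ->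
    forall f : W -> N, right_linear_on P f ->
    exists h : W -> M, right_linear_on P h /\ (forall w, P w -> g (h w) = f w).

Definition quasi_rigid S := forall n : int,
  finitely_generated (S `&` whomog n) /\ projective (S `&` whomog n).

End Rational.

Definition rational (k : comPzRingType) (U : gradedRing k) (R : kalg k) :=
  forall W : posGradedBimodule U R,
    exists (I : choiceType) (S : I -> set W),
      (forall i, [/\ graded_subbimodule (S i), graded_simple (S i) &
                     quasi_rigid (S i)]) /\
      direct_sum S.

(* Main.v *)
(* For n : int let M = U / N_L^{n+1} U and W = M (x)_k A_0, a positively-graded
   (U | A_0)-bimodule in degrees >= -n. By semisimplicity, its subbimodule
   U.W_{-n} has a graded complement, so 1 (x) 1 = \sum x_i y_i (x) a_i modulo
   vectors killed by U_{-n}, where x_i \in U_n and y_i \in U_{-n}.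

   The case n = 0 shows that elements of L^0 without trace in degree 0 vanish
   (L0_cogenerated), and that A_0 is separable over k, whence a k-linear
   t : A_0 -> Z(A_0) with t 1 = 1 (central_trace). Multiplying the first factor
   of W on the right by g \in U_n and applying t to the second one turns the
   decomposition of 1 (x) 1 into g = \sum x_i y_i g t(a_i) in L^0_n. As t(a_i)
   is central, it can be moved from the right of y_i g to its left, so
   1_n = \sum x_i t(a_i) (x) y_i acts on L^0_n as the identity.

   The same decomposition shows that an element of R^0_{-n} pairing to 0 with
   L^0_n vanishes (R0_cogenerated), so 1_n is also a right identity. *)
From HB Require Import structures.
From mathcomp Require Import all_boot all_order all_algebra.
From mathcomp Require Import finmap.
From mathcomp Require Import boolp classical_sets functions cardinality fsbigop.
Require Import Defs.

Set Implicit Arguments.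
Unset Strict Implicit.
Unset Printing Implicit Defensive.

Import Order.TTheory GRing.Theory Num.Theory.
Local Open Scope classical_set_scope.
Local Open Scope ring_scope.

(** * Additive maps, subgroups and direct sum decompositions *)

Section MorphB.
Variables (V G : zmodType) (f : V -> G).
Hypothesis fB : {morph f : x y / x - y}.

Lemma morphB_0 : f 0 = 0. Proof. by rewrite -(subrr 0) fB !subrr. Qed.

Lemma morphB_N x : f (- x) = - f x.
Proof. by rewrite -[- x]sub0r fB morphB_0 sub0r. Qed.

Lemma morphB_D : {morph f : x y / x + y}.
Proof. by move=> x y; rewrite -{1}[y]opprK fB morphB_N opprK. Qed.

End MorphB.

Lemma span_ind (V : zmodType) (X S : set V) :
  subgroup S -> X `<=` S -> span X `<=` S.
Proof.
move=> [S0 SB] XS v; elim=> {v} [v /XS|//|v w _ Sv _ Sw] //; exact: SB.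
Qed.

Lemma preim_subgroup (V V' : zmodType) (f : V -> V') (S : set V') :
  {morph f : x y / x - y} -> subgroup S -> subgroup (f @^-1` S).
Proof.
move=> fB gS; split; first by rewrite /= (morphB_0 fB); case: gS.
by move=> x y /= Sx Sy; rewrite /preimage /= fB; exact: (proj2 gS).
Qed.

Lemma eq_subgroup (V G : zmodType) (f g : V -> G) : {morph f : x y / x - y} ->
  {morph g : x y / x - y} -> subgroup [set x | f x = g x].
Proof.
move=> fB gB; split=> [|x y] /=; first by rewrite -(subrr 0) fB gB !subrr.
by rewrite fB gB => -> ->.
Qed.

Lemma tensor_ext (A : Type) (M N G : zmodType) (ra : M -> A -> M)
    (la : A -> N -> N) (f g : tensor ra la -> G) :
  {morph f : s t / s - t} -> {morph g : s t / s - t} ->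
  (forall m n, f (tens ra la m n) = g (tens ra la m n)) -> f =1 g.
Proof. by move=> fB gB fg t; apply: (tensor_ind _ (eq_subgroup fB gB)). Qed.

(** Applied to the finite sum, [p] kills every term but the one at [i]. This gives the uniqueness
    half of [direct_sum_proj]. *)
Lemma fsum_proj (V : zmodType) (I : choiceType) (M : I -> set V) (p : V -> V)
    (i : I) (v : V) (f : I -> V) :
  {morph p : x y / x - y} -> (forall x, M i x -> p x = x) ->
  (forall j x, j != i -> M j x -> p x = 0) ->
  decomposition M v f -> p v = f i.
Proof.
move=> pB p_id p_0 [Mf fin_f ->].
(* The index [i] is added to the support because [f i] may vanish. *)
have fin' : finite_set (([set i | f i != 0]) `|` [set i]).
  by rewrite finite_setU; split.
rewrite -(fsbig_widen ([set i | f i != 0] `|` [set i]) [set: I]) //; last first.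
  by move=> j /= [_ nj]; apply: contrapT => /eqP fj; apply: nj; left.
rewrite fsbig_finite //= (big_morph p (morphB_D pB) (morphB_0 pB)).
rewrite (eq_bigr (fun j => if j == i then f i else 0)); last first.
  by move=> j _; case: eqVneq => [->|ji]; [exact: p_id|exact: (p_0 j)].
rewrite (big_fsetD1 i) /=; last first.
  by rewrite in_fset_set // inE; right.
rewrite eqxx big1_fset ?addr0 // => j.
by rewrite in_fsetD1 => /andP[/negPf ->].
Qed.

(** Unlike [componentB], this is available before the sum is known to be direct. All three sums are
    taken over the union of the two supports. *)
Lemma decompositionB (V : zmodType) (I : choiceType) (M : I -> set V)
    (v w : V) (f g : I -> V) : (forall i, subgroup (M i)) ->
  decomposition M v f -> decomposition M w g ->
  decomposition M (v - w) (fun i => f i - g i).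
Proof.
move=> gM [Mf fin_f ->] [Mg fin_g ->].
set D := [set i | f i != 0] `|` [set i | g i != 0].
have fin_D : finite_set D by rewrite finite_setU.
have widen (h : I -> V) : (forall i, h i != 0 -> D i) ->
    \sum_(i \in [set: I]) h i = \sum_(i \in D) h i.
  move=> hD; apply/esym/fsbig_widen => // i [_ nDi] /=.
  by apply: contrapT => /eqP /hD.
have fgD i : f i - g i != 0 -> D i.
  have [->|] := eqVneq (f i) 0; last by left.
  by rewrite sub0r oppr_eq0; right.
split; first by move=> i; apply: (proj2 (gM i)).
  exact: sub_finite_set fgD fin_D.
rewrite (widen f); last by left.
rewrite (widen g); last by right.
by rewrite widen // !fsbig_finite //= big_split /= sumrN.
Qed.

Lemma decomposition_homog (V : zmodType) (I : choiceType) (M : I -> set V)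
    (i : I) (v : V) : (forall j, subgroup (M j)) -> M i v ->
  decomposition M v (fun j => if j == i then v else 0).
Proof.
move=> gM Mv; split.
- by move=> j; case: eqP => [->//|_]; exact: (proj1 (gM j)).
- apply: (@sub_finite_set _ _ [set i]) => [j /=|]; last exact: finite_set1.
  by case: (eqVneq j i) => // _; rewrite eqxx.
- rewrite -(fsbig_widen [set i] [set: I]) ?fsbig_set1 ?eqxx//.
  by move=> j /= [_ /eqP/negPf ->].
Qed.

(** Used to grade quotients and tensor products. Uniqueness is [fsum_proj]; for existence, the
    vectors decomposed by the projections form a subgroup containing every [M i]. *)
Lemma direct_sum_proj (V : zmodType) (I : choiceType) (M : I -> set V)
    (p : I -> V -> V) :
  (forall i, subgroup (M i)) -> (forall i, {morph p i : x y / x - y}) ->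
  (forall i x, M i x -> p i x = x) ->
  (forall i j x, j != i -> M j x -> p i x = 0) ->
  (forall S : set V, subgroup S -> (forall i x, M i x -> S x) ->
    forall x, S x) ->
  direct_sum M.
Proof.
move=> gM pB p_id p_0 gen v; exists (p^~ v); split; last first.
  move=> f dec_f; apply/funext => i.
  by apply: fsum_proj dec_f => [//|x|j x]; [exact: p_id|exact: p_0].
have pE i x : M i x -> p^~ x = (fun j => if j == i then x else 0).
  move=> Mx; apply/funext => j; have [->|ij] := eqVneq j i; first exact: p_id.
  by rewrite (p_0 j i) // eq_sym.
apply: (gen [set x | decomposition M x (p^~ x)]) => [|i x Mx].
  split=> [|x y dx dy] /=.
    have -> : p^~ 0 = fun=> 0 by apply/funext => i; exact: morphB_0.
    split=> [i||]; first exact: (proj1 (gM i)).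
      by apply: (sub_finite_set _ (finite_set0 _)) => i; rewrite /= eqxx.
    by rewrite fsbig1.
  have -> : p^~ (x - y) = (fun i => p i x - p i y).
    by apply/funext => i; rewrite pB.
  exact: decompositionB.
by rewrite /= (pE _ _ Mx); exact: decomposition_homog.
Qed.

Lemma component_morphB (V : zmodType) (I : choiceType) (M : I -> set V)
    (gM : forall i, subgroup (M i)) (dM : direct_sum M) i :
  {morph (fun v => component M v i) : x y / x - y}.
Proof. by move=> x y; rewrite /= componentB. Qed.
(** * Complements in semisimple graded bimodules *)

Section Complement.
Variables (k : comPzRingType) (U : gradedRing k) (R : kalg k).
Variable W : posGradedBimodule U R.
Implicit Types K C : set W.

Definition sumset K C : set W := [set x + y | x in K & y in C].

Lemma sumset_graded K C : graded_subbimodule K -> graded_subbimodule C ->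
  graded_subbimodule (sumset K C).
Proof.
move=> [gK sK rK hK] [gC sC rC hC]; split.
- split; first by exists 0; [|exists 0; [|exact: addr0]];
    [exact: (proj1 gK)|exact: (proj1 gC)].
  move=> _ _ [x Kx [y Cy <-]] [x' Kx' [y' Cy' <-]].
  exists (x - x'); first exact: (proj2 gK).
  exists (y - y'); first exact: (proj2 gC).
  by rewrite opprD addrACA.
- move=> u _ [x Kx [y Cy <-]]; exists (u *: x); first exact: sK.
  by exists (u *: y); [exact: sC|rewrite scalerDr].
- move=> _ a [x Kx [y Cy <-]]; exists (ract x a); first exact: rK.
  by exists (ract y a); [exact: rC|rewrite ractDl].
- move=> _ n [x Kx [y Cy <-]].
  exists (component (@whomog k U R W) x n); first exact: hK.
  exists (component (@whomog k U R W) y n); first exact: hC.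
  exact/esym/(morphB_D (component_morphB (@whomogB _ _ _ W) (@whomog_sum _ _ _
    W) n)).
Qed.

Lemma bigcup_graded (F : set (set W)) :
  (forall C, F C -> graded_subbimodule C) ->
  total_on F subset -> F !=set0 -> graded_subbimodule (\bigcup_(C in F) C).
Proof.
move=> gF totF [C0 FC0]; split.
- split; first by exists C0 => //; have [[]] := gF _ FC0.
  move=> x y [C FC Cx] [C' FC' C'y]; have [CC'|C'C] := totF _ _ FC FC'.
    by exists C' => //; have [[_ gC'] _ _ _] := gF _ FC'; apply: gC' => //;
      exact: CC'.
  by exists C => //; have [[_ gC] _ _ _] := gF _ FC; apply: gC => //;
    exact: C'C.
- by move=> u w [C FC Cw]; exists C => //; have [_ + _ _] := gF _ FC; apply.
- by move=> w a [C FC Cw]; exists C => //; have [_ _ + _] := gF _ FC; apply.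
- by move=> w n [C FC Cw]; exists C => //; have [_ _ _ +] := gF _ FC; apply.
Qed.

Lemma graded_subbimodule0 : graded_subbimodule [set 0 : W].
Proof.
split.
- by split=> // x y -> ->; rewrite /= subrr.
- by move=> u _ ->; exact: scaler0.
- move=> _ a ->; apply: (addrI (ract (0 : W) a)).
  by rewrite -ractDl !addr0.
- move=> _ n ->.
  rewrite (component_homog (@whomogB _ _ _ W) (i := n) (@whomog_sum _ _ _ W)).
    by rewrite eqxx.
  exact: (proj1 (@whomogB _ _ _ W n)).
Qed.

Lemma graded_subbimoduleI K C : graded_subbimodule K -> graded_subbimodule C ->
  graded_subbimodule (K `&` C).
Proof.
move=> [gK sK rK hK] [gC sC rC hC]; split.
- split; first by split; [exact: (proj1 gK)|exact: (proj1 gC)].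
  by move=> x y [Kx Cx] [Ky Cy]; split; [exact: (proj2 gK)|exact: (proj2 gC)].
- by move=> u w [Kw Cw]; split; [exact: sK|exact: sC].
- by move=> w a [Kw Cw]; split; [exact: rK|exact: rC].
- by move=> w n [Kw Cw]; split; [exact: hK|exact: hC].
Qed.

(** Zorn's lemma gives [C] maximal with zero intersection with [K]. Each simple summand [S i] meets
    [K + C] in all of [S i] or in 0; in the second case [C + S i] still meets [K] trivially, so
    [S i] lies in [C] by maximality. Hence [K + C] contains every summand. *)
Lemma sumset_complement (I : choiceType) (S : I -> set W) K :
    (forall i, graded_subbimodule (S i) /\ graded_simple (S i)) ->
    direct_sum S -> graded_subbimodule K ->
  exists C, [/\ graded_subbimodule C, K `&` C `<=` [set 0] &
                forall w, sumset K C w].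
Proof.
move=> sS dS gK.
pose P : set (set W) := [set C | [/\ C = set0 \/ graded_subbimodule C &
  K `&` C `<=` [set 0]]].
have [|C [[gC KC] maxC]] := @Zorn_bigcup _ P.
  move=> F FP totF; split; last first.
    by move=> w [Kw [C FC Cw]]; have [_] := FP _ FC; apply.
  have [F0|] := pselect (exists2 C, F C & C <> set0); last first.
    move=> nF; left; apply/seteqP; split=> // w [C FC Cw].
    by apply: nF; exists C => // C0; rewrite C0 in Cw.
  right; have -> : \bigcup_(C in F) C =
    \bigcup_(C in F `&` [set C | C <> set0]) C.
    apply/seteqP; split=> w [C]; last by move=> [FC _] Cw; exists C.
    by move=> FC Cw; exists C => //; split=> // C0; rewrite C0 in Cw.
  apply: bigcup_graded.
  - by move=> C [FC nC]; have [[]] := FP _ FC.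
  - by move=> C C' [FC _] [FC' _]; exact: totF.
  - by have [C FC nC] := F0; exists C.
(* A maximal [C] cannot be empty, since the zero subbimodule would be strictly larger. *)
have {}gC : graded_subbimodule C.
  case: gC => // C0; case: (maxC [set 0]); last first.
    split; first by right; exact: graded_subbimodule0.
    by move=> w [].
  by rewrite C0; split=> [w //|/(_ 0)]; apply.
have gKC := sumset_graded gK gC.
exists C; split=> // w.
apply: (component_ind dS); first by case: gKC.
move=> i; have [Sw _ _] := component_decomposition w dS.
set v := component S w i; have {Sw} : S i v by [].
have [gS [_ simpS]] := sS i.
have [KCS0|KCS] := simpS _ (graded_subbimoduleI gS gKC) (@subIsetl _ _ _);
  last first.
  by rewrite -KCS => -[].
move=> Sv.
have CCS : C `<=` sumset C (S i).
  move=> x Cx; exists x => //; exists 0; last exact: addr0.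
  by case: gS => -[].
have KCK x y : K x -> C y -> sumset K C (x + y) by move=> Kx Cy;
  exists x => //; exists y.
have K0 : K 0 by case: gK => -[].
have C0 : C 0 by case: gC => -[].
have PCS : P (sumset C (S i)).
  split; first by right; exact: sumset_graded.
  move=> y [Kxs [x Cx [s Ss xsE]]]; rewrite -{y}xsE in Kxs *.
  (* As [x + s] is in [K] and [x] in [C], the vector [s] lies in the intersection of [S i] with
     [K + C], which is 0 in this case. *)
  have s0 : s = 0.
    have : (S i `&` sumset K C) s.
      split => //; rewrite -[s](addKr x) addrC; apply: KCK => //.
      by apply: subgroupN => //; case: gC.
    by rewrite KCS0.
  by apply: KC; rewrite s0 addr0 in Kxs *.
have : ~ C `<` sumset C (S i) by move=> /maxC.
move=> nC; have : sumset C (S i) v by exists 0 => //; exists v => //;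
  exact: add0r.
move=> CSv; rewrite -[v]add0r; apply: KCK => //; apply: contrapT => nCv.
by apply: nC; split=> // /(_ _ CSv).
Qed.

End Complement.

(** * The bimodule [M (x)_k T] of a left module M *)

Section Induced.
Variables (k : comPzRingType) (S T : kalg k) (M : lmodType S).

(** The scalars act on [M] through [kin S]. Their centrality in [S] is what lets the left [S]-action
    descend to the tensor product. *)
Definition induced := tensor (fun (u : M) (c : k) => kin S c *: u)
  (fun c (a : T) => kin T c * a).

HB.instance Definition _ := GRing.Zmodule.on induced.

Definition itens (u : M) (a : T) : induced := tens _ _ u a.

Lemma itensDl u v a : itens (u + v) a = itens u a + itens v a.
Proof. by have [] := tens_balanced (fun (u : M) (c : k) => kin S c *: u)
  (fun c (a : T) => kin T c * a). Qed.

Lemma itensDr u a b : itens u (a + b) = itens u a + itens u b.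
Proof. by have [] := tens_balanced (fun (u : M) (c : k) => kin S c *: u)
  (fun c (a : T) => kin T c * a). Qed.

Lemma itens_kin c u a : itens (kin S c *: u) a = itens u (kin T c * a).
Proof. by have [] := tens_balanced (fun (u : M) (c : k) => kin S c *: u)
  (fun c (a : T) => kin T c * a). Qed.

Lemma itensBl u v a : itens (u - v) a = itens u a - itens v a.
Proof. by apply: (addIr (itens v a)); rewrite -itensDl !subrK. Qed.

Lemma itens0l a : itens 0 a = 0.
Proof. by rewrite -(subrr 0) itensBl subrr. Qed.

Definition ilift (G : zmodType) (f : M -> T -> G) : induced -> G :=
  tensor_lift f.

Definition kbilinear (G : zmodType) (f : M -> T -> G) :=
  balanced (fun (u : M) (c : k) => kin S c *: u) (fun c (a : T) =>
    kin T c * a) f.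

Lemma ilift_itens (G : zmodType) (f : M -> T -> G) :
  kbilinear f -> forall u a, ilift f (itens u a) = f u a.
Proof. by move=> fP u a; exact: (tensor_lift_tens fP). Qed.

Lemma iliftB (G : zmodType) (f : M -> T -> G) :
  kbilinear f -> {morph ilift f : s t / s - t}.
Proof. by move=> fP; exact: (tensor_liftB fP). Qed.

Lemma induced_ext (G : zmodType) (f g : induced -> G) :
  {morph f : s t / s - t} -> {morph g : s t / s - t} ->
  (forall u a, f (itens u a) = g (itens u a)) -> f =1 g.
Proof. exact: tensor_ext. Qed.

Definition iscale (x : S) : induced -> induced :=
  ilift (fun u a => itens (x *: u) a).
Definition iract (w : induced) (b : T) : induced :=
  ilift (fun u a => itens u (a * b)) w.

Let scale_kbil x : kbilinear (fun u a => itens (x *: u) a).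
Proof.
split=> *; rewrite ?scalerDr ?itensDl ?itensDr //.
by rewrite scalerA -kin_central -scalerA itens_kin.
Qed.

Let ract_kbil b : kbilinear (fun u a => itens u (a * b)).
Proof.
by split=> *; rewrite ?mulrDl ?itensDl ?itensDr // itens_kin mulrA.
Qed.

Lemma iscale_itens x u a : iscale x (itens u a) = itens (x *: u) a.
Proof. by rewrite /iscale ilift_itens. Qed.

Lemma iract_itens b u a : iract (itens u a) b = itens u (a * b).
Proof. by rewrite /iract ilift_itens. Qed.

Let iscaleB x : {morph iscale x : s t / s - t}. Proof. exact: iliftB. Qed.
Let iractB b : {morph iract^~ b : s t / s - t}. Proof. exact: iliftB. Qed.

Let compB (V1 V2 V3 : zmodType) (f : V2 -> V3) (g : V1 -> V2) :
  {morph f : s t / s - t} -> {morph g : s t / s - t} ->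
  {morph f \o g : s t / s - t}.
Proof. by move=> fB gB s t /=; rewrite gB fB. Qed.

Let addB (V1 V2 : zmodType) (f g : V1 -> V2) :
  {morph f : s t / s - t} -> {morph g : s t / s - t} ->
  {morph (fun s => f s + g s) : s t / s - t}.
Proof. by move=> fB gB s t /=; rewrite gB fB opprD addrACA. Qed.

Fact iscaleA x y w : iscale x (iscale y w) = iscale (x * y) w.
Proof.
apply: (induced_ext (f := iscale x \o iscale y)) w => [||u a /=].
- exact: compB.
- exact: iscaleB.
- by rewrite !iscale_itens scalerA.
Qed.

Fact iscale1 w : iscale 1 w = w.
Proof.
apply: (induced_ext (g := id)) w => [//|//|u a].
by rewrite iscale_itens scale1r.
Qed.

Fact iscaleDr : right_distributive iscale +%R.
Proof. by move=> x; exact: morphB_D. Qed.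

Fact iscaleDl w : {morph iscale^~ w : x y / x + y}.
Proof.
move=> x y; apply: (induced_ext
  (g := fun w => iscale x w + iscale y w)) w => //.
  exact: addB.
by move=> u a; rewrite !iscale_itens scalerDl itensDl.
Qed.

HB.instance Definition _ := GRing.Zmodule_isLmodule.Build S induced
  iscaleA iscale1 iscaleDr iscaleDl.

Lemma scale_itens x u a : x *: itens u a = itens (x *: u) a.
Proof. exact: iscale_itens. Qed.

Fact iractDl v w a : iract (v + w) a = iract v a + iract w a.
Proof. exact: (morphB_D (iractB a)). Qed.

Fact iractDr w a b : iract w (a + b) = iract w a + iract w b.
Proof.
apply: (induced_ext (f := iract^~ (a + b))
  (g := fun w => iract w a + iract w b)) w => //.
  exact: (addB (iractB a) (iractB b)).
by move=> u c; rewrite !iract_itens mulrDr itensDr.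
Qed.

Fact iractA w a b : iract w (a * b) = iract (iract w a) b.
Proof.
apply: (induced_ext (f := iract^~ (a * b))
  (g := iract^~ b \o iract^~ a)) w => //.
  exact: (compB (iractB b) (iractB a)).
by move=> u c /=; rewrite !iract_itens mulrA.
Qed.

Fact iract1 w : iract w 1 = w.
Proof.
apply: (induced_ext (f := iract^~ 1) (g := id)) w => // u a.
by rewrite iract_itens mulr1.
Qed.

Fact iract_scale x w a : iract (x *: w) a = x *: iract w a.
Proof.
apply: (induced_ext (f := iract^~ a \o iscale x)
  (g := iscale x \o iract^~ a)) w => //.
- exact: (compB (iractB a) (iscaleB x)).
- exact: (compB (iscaleB x) (iractB a)).
- by move=> u b /=; rewrite iract_itens !iscale_itens iract_itens.
Qed.

Fact iract_kin c w : iract w (kin T c) = kin S c *: w.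
Proof.
apply: (induced_ext (f := iract^~ (kin T c))
  (g := iscale (kin S c))) w => // u a.
by rewrite iract_itens iscale_itens itens_kin kin_central.
Qed.

Definition induced_bimodule : bimodule S T :=
  Bimodule iractDl iractDr iractA iract1 iract_scale iract_kin.

Lemma ract_itens u a b :
  ract (itens u a : induced_bimodule) b = itens u (a * b).
Proof. exact: iract_itens. Qed.

End Induced.

Arguments itens {k S T M} u a.

Lemma ractB (k : comPzRingType) (S T : kalg k) (M : bimodule S T) (v w : M) a :
  ract (v - w) a = ract v a - ract w a.
Proof. by apply: (addIr (ract w a)); rewrite -ractDl !subrK. Qed.

Lemma ract0 (k : comPzRingType) (S T : kalg k) (M : bimodule S T) a :
  ract (0 : M) a = 0.
Proof. by rewrite -(subrr 0) ractB !subrr. Qed.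

Lemma component_scale (k : comPzRingType) (U : gradedRing k) (M : lmodType U)
    (G : int -> set M) :
  (forall p, subgroup (G p)) ->
  (forall p q (x : U) u, homog p x -> G q u -> G (p + q) (x *: u)) ->
  direct_sum G ->
  forall p q (x : U) u, homog p x ->
  component G (x *: u) (p + q) = x *: component G u q.
Proof.
move=> gG G_scale G_sum p q x u Ux.
apply: (component_ind (S := [set u | component G (x *: u) (p + q) =
  x *: component G u q]) (v := u) G_sum).
  by apply: eq_subgroup => v w;
    rewrite ?scalerBr (component_morphB gG) ?scalerBr.
move=> r; have [Gu _ _] := component_decomposition u G_sum.
rewrite /= (component_homog gG G_sum (G_scale _ _ _ _ Ux (Gu r))).
rewrite (component_homog gG G_sum (Gu r)).
by rewrite (inj_eq (addrI p)); case: eqP => // _; rewrite scaler0.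
Qed.

(** * The grading of the induced bimodule by the degree of its left factor *)

Section InducedGraded.
Variables (k : comPzRingType) (U : gradedRing k) (R : kalg k) (M : lmodType U).
Variable G : int -> set M.
Hypothesis gG : forall p, subgroup (G p).
Hypothesis G_scale : forall p q (x :
  U) u, homog p x -> G q u -> G (p + q) (x *: u).
Hypothesis G_sum : direct_sum G.
Hypothesis G_bounded : exists N : int, forall p, p < N -> G p `<=` [set 0].

Local Notation W := (induced R M).

Definition ihomog (p : int) : set W :=
  span [set itens u a | u in G p & a in [set: R]].

Lemma ihomog_itens p u a : G p u -> ihomog p (itens u a).
Proof. by move=> Gu; apply: span_gen; exists u => //; exists a. Qed.

Let gW p : subgroup (ihomog p) := span_subgroup _.

Lemma induced_ind (S : set W) w : subgroup S ->
  (forall p u a, G p u -> S (itens u a)) -> S w.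
Proof.
move=> gS Sh; apply: (tensor_ind (P := S)) => // u a; rewrite -/(itens u a).
have gSa : subgroup [set v | S (itens v a)].
  by apply: (preim_subgroup (f := fun v => itens v a)) => // x y;
    exact: itensBl.
apply: (component_ind (v := u) G_sum gSa) => p /=.
by apply: Sh; have [] := component_decomposition u G_sum.
Qed.

Let ihomog_ract n (w : induced_bimodule R M) a :
  ihomog n w -> ihomog n (ract w a).
Proof.
move: w; apply: span_ind.
  by apply: (preim_subgroup (f := fun w => ract w a)) => // v w; exact: ractB.
move=> _ [u Gu [b _ <-]]; rewrite /preimage /mkset ract_itens.
exact: ihomog_itens.
Qed.

Let ihomog_scale p n (x : U) (w : induced_bimodule R M) :
  homog p x -> ihomog n w -> ihomog (p + n) (x *: w).
Proof.
move=> Ux; move: w; apply: span_ind.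
  by apply: (preim_subgroup (f := fun w => x *: w)) => // v w; exact: scalerBr.
move=> _ [u Gu [b _ <-]]; rewrite /preimage /mkset scale_itens.
by apply: ihomog_itens; exact: G_scale.
Qed.

Let iproj p : W -> W := ilift (fun u a => itens (component G u p) a).

(** Scalars have degree 0, so taking components is k-linear and [iproj] is well defined on the
    tensor product. *)
Let kin_component c u p :
  component G (kin U c *: u) p = kin U c *: component G u p.
Proof.
have Uc : homog 0 (kin U c) by rewrite -[kin U c]mulr1; exact/homogZ/homog1.
by rewrite -{1}[p]add0r (component_scale gG G_scale).
Qed.

Let ihomog_sum : direct_sum ihomog.
Proof.
have kb p : kbilinear (fun u (a : R) => itens (component G u p) a).
  split=> *; rewrite ?itensDr -?itensDl ?kin_component ?itens_kin //.
  by congr itens; apply: (morphB_D (component_morphB gG G_sum p)).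
apply: (direct_sum_proj (p := iproj)) => //.
- by move=> p; exact: iliftB.
- move=> p w; move: w; apply: span_ind.
    by apply: eq_subgroup => //; exact: iliftB.
  move=> _ [u Gu [a _ <-]]; rewrite /= /iproj ilift_itens //.
  by rewrite (component_homog gG G_sum Gu) eqxx.
- move=> p q w qp; move: w; apply: span_ind.
    apply: eq_subgroup; first exact: iliftB.
    by move=> ? ?; rewrite subrr.
  move=> _ [u Gu [a _ <-]]; rewrite /= /iproj ilift_itens //.
  by rewrite (component_homog gG G_sum Gu) eq_sym (negPf qp) itens0l.
- move=> S gS Sh w; apply: induced_ind => // p u a Gu.
  by apply: (Sh p); exact: ihomog_itens.
Qed.

Let ihomog_bounded : exists N : int, forall n, n < N -> ihomog n `<=` [set 0].
Proof.
have [N GN] := G_bounded; exists N => n nN; apply: span_ind.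
  by split=> // x y -> ->; rewrite /= subrr.
by move=> _ [u /(GN _ nN) -> [a _ <-]]; rewrite itens0l.
Qed.

Definition induced_graded : posGradedBimodule U R :=
  @PosGradedBimodule k U R (induced_bimodule R M) ihomog gW ihomog_ract
    ihomog_scale ihomog_sum ihomog_bounded.

End InducedGraded.

(** * The bimodules [U / N_L^m U (x)_k A_0] *)

Section ZhuModules.
Variables (k : comPzRingType) (U : acsRing k).

Definition Lquot (m : int) := quotient (NL_B U m).
HB.instance Definition _ m := GRing.Zmodule.on (Lquot m).

Definition lclass m (x : U) : Lquot m := qclass (NL_B U m) x.

Lemma lclassP m x y : lclass m x = lclass m y <-> NL m (x - y).
Proof. exact: qclassP. Qed.

Lemma lclass_repr m (u : Lquot m) : lclass m (repr u) = u.
Proof. exact: qclass_repr. Qed.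

Lemma lclassB m : {morph lclass m : x y / x - y}.
Proof. exact: (raddfB (qclass _)). Qed.

Lemma lclassD m : {morph lclass m : x y / x + y}.
Proof. exact: (raddfD (qclass _)). Qed.

(** Maps out of a quotient are written as composites with [repr]; this makes them independent of the
    chosen representative. *)
Lemma qlift_class m (G : zmodType) (f : U -> G) : {morph f : x y / x - y} ->
  (forall x, NL m x -> f x = 0) -> forall x, f (repr (lclass m x)) = f x.
Proof.
move=> fB f0 x; apply/subr0_eq; rewrite -fB; apply: f0; exact: repr_qclass.
Qed.

Definition Lquot_scale m (x : U) (u : Lquot m) : Lquot m :=
  lclass m (x * repr u).

Lemma Lquot_scale_lclass m x y : Lquot_scale x (lclass m y) = lclass m (x * y).
Proof.
apply: (qlift_class (f := fun y => lclass m (x * y))) => [y1 y2|z Nz].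
  by rewrite mulrBr lclassB.
by rewrite -(morphB_0 (@lclassB m)); apply/lclassP; rewrite subr0;
  exact: NL_mull_all.
Qed.

Fact Lquot_scaleA m x y (u : Lquot m) :
  Lquot_scale x (Lquot_scale y u) = Lquot_scale (x * y) u.
Proof. by rewrite -[u]lclass_repr !Lquot_scale_lclass mulrA. Qed.
Fact Lquot_scale1 m (u : Lquot m) : Lquot_scale 1 u = u.
Proof. by rewrite -[u]lclass_repr !Lquot_scale_lclass mul1r. Qed.
Fact Lquot_scaleDr m : right_distributive (@Lquot_scale m) +%R.
Proof.
by move=> x u v; rewrite -[u]lclass_repr -[v]lclass_repr -lclassD
  !Lquot_scale_lclass mulrDr lclassD.
Qed.
Fact Lquot_scaleDl m (u : Lquot m) : {morph (@Lquot_scale m)^~ u : x y / x + y}.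
Proof. by move=> x y; rewrite -[u]lclass_repr !Lquot_scale_lclass mulrDl
  lclassD. Qed.

HB.instance Definition _ m := GRing.Zmodule_isLmodule.Build U (Lquot m)
  (@Lquot_scaleA m) (@Lquot_scale1 m) (@Lquot_scaleDr m) (@Lquot_scaleDl m).

Lemma scale_lclass m (x y : U) : x *: lclass m y = lclass m (x * y).
Proof. exact: Lquot_scale_lclass. Qed.

HB.instance Definition _ := GRing.Lmodule.copy (L0 U) (Lquot 1).

Lemma scale_piL (x y : U) : x *: piL y = piL (x * y).
Proof. exact: (@scale_lclass 1). Qed.

Definition Lquot_homog m p : set (Lquot m) := [set lclass m x | x in homog p].

Let dU := @homog_sum k U.
Let cU := @component _ _ (@homog k U).

Lemma cU_homog x p : homog p (cU x p).
Proof. by have [] := component_decomposition x dU. Qed.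

Fact Lquot_homogB m p : subgroup (@Lquot_homog m p).
Proof.
split; first by exists 0; [exact: (proj1 (homogB U p))|exact: morphB_0
  (@lclassB m)].
move=> _ _ [x Ux <-] [y Uy <-]; exists (x - y); last exact: lclassB.
exact: (proj2 (homogB U p)).
Qed.

Fact Lquot_homog_scale m p q (x : U) (u : Lquot m) :
  homog p x -> Lquot_homog q u -> Lquot_homog (p + q) (x *: u).
Proof.
move=> Ux [y Uy <-]; exists (x * y); first exact: homogM.
by rewrite scale_lclass.
Qed.

Fact Lquot_homog_sum m : direct_sum (@Lquot_homog m).
Proof.
have cB p : {morph (fun x => lclass m (cU x p)) : x y / x - y}.
  by move=> x y; rewrite /cU (component_morphB (homogB U) dU) lclassB.
have c0 p x : NL m x -> lclass m (cU x p) = 0.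
  move=> Nx; rewrite -(morphB_0 (@lclassB m)); apply/lclassP.
  by rewrite subr0; exact: NL_graded.
pose f p (u : Lquot m) := lclass m (cU (repr u) p).
have fE p x : f p (lclass m x) = lclass m (cU x p).
  exact: (qlift_class (cB p) (c0 p)).
apply: (direct_sum_proj (p := f)).
- exact: Lquot_homogB.
- by move=> p u v; rewrite -[u]lclass_repr -[v]lclass_repr -lclassB !fE cB.
- by move=> p _ [x Ux <-];
  rewrite fE /cU (component_homog (homogB U) dU Ux) eqxx.
- move=> p q _ qp [x Ux <-]; rewrite fE /cU (component_homog (homogB U) dU Ux).
  by rewrite eq_sym (negPf qp) (morphB_0 (@lclassB m)).
- move=> S gS Sh u; rewrite -[u]lclass_repr.
  apply: (component_ind (v := repr u) dU (preim_subgroup (@lclassB m) gS)) => p.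
  by apply: (Sh p); exists (cU (repr u) p) => //; exact: cU_homog.
Qed.

(** Writing [x] as [1 * x] puts it in the left ideal U . U_{<= -m}, which N_L^m U contains. *)
Lemma NL_low m p (x : U) : p <= - m -> homog p x -> NL m x.
Proof.
move=> pm Ux; apply: NL_left; rewrite -[x]mul1r.
by apply: span_gen; exists 1 => //; exists x => //; apply: span_gen; exists p.
Qed.

Fact Lquot_homog_bounded m :
  exists N : int, forall p, p < N -> @Lquot_homog m p `<=` [set 0].
Proof.
(* [p < 1 - m] means [p <= - m], the range of [NL_low]. For [m = n + 1] this bound is [- n]. *)
exists (1 - m) => p pm _ [x Ux <-]; rewrite /= -(morphB_0 (@lclassB m)).
apply/lclassP; rewrite subr0; apply: NL_low Ux.
by rewrite -ltzD1 addrC.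
Qed.

(** * The graded bimodules U / N_L^m U (x)_k A_0 and the additive maps out of them *)

Definition Wmod m : posGradedBimodule U (zhu U) := induced_graded (zhu U)
  (@Lquot_homogB m) (@Lquot_homog_scale m) (@Lquot_homog_sum m)
    (@Lquot_homog_bounded m).

Definition wtens m (x : U) (a : zhu U) : Wmod m := itens (lclass m x) a.

Lemma wtensDl m x y a : wtens m (x + y) a = wtens m x a + wtens m y a.
Proof. by rewrite /wtens lclassD; exact: itensDl. Qed.

Lemma wtensB m a : {morph (fun x => wtens m x a) : x y / x - y}.
Proof. by move=> x y; apply: (addIr (wtens m y a));
  rewrite /= -wtensDl !subrK. Qed.

Lemma wtens_NL m x a : NL m x -> wtens m x a = 0.
Proof.
move=> Nx; have /lclassP xE : NL m (x - 0) by rewrite subr0.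
by rewrite /wtens xE (morphB_0 (@lclassB m)); exact: itens0l.
Qed.

Lemma wtens_scale m y x a : y *: wtens m x a = wtens m (y * x) a.
Proof. by rewrite /wtens -scale_lclass; exact: scale_itens. Qed.

Lemma wtens_ract m x a b : ract (wtens m x a) b = wtens m x (a * b).
Proof. exact: ract_itens. Qed.

Lemma wtens_homog m p x a : homog p x -> whomog p (wtens m x a).
Proof. by move=> Ux; apply: ihomog_itens; exists x. Qed.

Lemma wtens_component m p x a : homog p x ->
  component (@whomog _ _ _ (Wmod m)) (wtens m x a) =
    fun q => if q == p then wtens m x a else 0.
Proof.
move=> Ux; apply: component_homog; first exact: whomogB.
  exact: whomog_sum.
exact: wtens_homog.
Qed.

Lemma Wmod_ind m (S : set (Wmod m)) w : subgroup S ->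
  (forall p x a, homog p x -> S (wtens m x a)) -> S w.
Proof.
move=> gS Sh; refine (@induced_ind _ _ _ _ _ (@Lquot_homog_sum m) S w gS _) =>
  p _ a [x Ux <-].
exact: (Sh p).
Qed.

(** The conditions under which [wlift f] is well defined on [Wmod m]: biadditive, balanced over [k],
    and zero on N_L^m U. *)
Record trilinear m (G : zmodType) (f : U -> zhu U -> G) := Trilinear {
  trilinDl : forall x y a, f (x + y) a = f x a + f y a;
  trilinDr : forall x a b, f x (a + b) = f x a + f x b;
  trilin_kin : forall c x a, f (kin U c * x) a = f x (kin (zhu U) c * a);
  trilin_NL : forall x a, NL m x -> f x a = 0
}.

Definition wlift m (G : zmodType) (f : U -> zhu U -> G) : Wmod m -> G :=
  ilift (fun (u : Lquot m) a => f (repr u) a).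

Section WLift.
Variables (m : int) (G : zmodType) (f : U -> zhu U -> G).
Hypothesis fP : trilinear m f.

Let f_repr x a : f (repr (lclass m x)) a = f x a.
Proof.
apply: (qlift_class (f := f^~ a)) => [y z|y]; last exact: (trilin_NL fP).
by apply: (addIr (f z a)); rewrite -(trilinDl fP) !subrK.
Qed.

Let f_kbil : kbilinear (fun (u : Lquot m) a => f (repr u) a).
Proof.
split=> [u v a|u a b|u c a]; last 2 first.
- exact: trilinDr fP _ _ _.
- by rewrite -[u in _ *: u]lclass_repr scale_lclass f_repr (trilin_kin fP).
by rewrite -{1}[u]lclass_repr -{1}[v]lclass_repr -lclassD f_repr (trilinDl fP).
Qed.

Lemma wlift_wtens x a : wlift f (wtens m x a) = f x a.
Proof. by rewrite /wlift [LHS](ilift_itens f_kbil) f_repr. Qed.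

Lemma wliftB : {morph wlift (m := m) f : v w / v - w}.
Proof. exact: (iliftB f_kbil). Qed.

End WLift.

End ZhuModules.

Lemma rational_complement (k : comPzRingType) (U : gradedRing k) (R : kalg k)
    (W : posGradedBimodule U R) (K : set W) :
  rational U R -> graded_subbimodule K ->
  exists C, [/\ graded_subbimodule C, K `&` C `<=` [set 0] &
                forall w, sumset K C w].
Proof.
move=> /(_ W)[I [S [sS dS]]]; apply: sumset_complement dS.
by move=> i; have [] := sS i.
Qed.

Lemma component_ract (k : comPzRingType) (U : gradedRing k) (R : kalg k)
    (W : posGradedBimodule U R) (w : W) (a : R) n :
  component (@whomog _ _ _ W) (ract w a) n =
  ract (component (@whomog _ _ _ W) w n) a.
Proof.
have gW := @whomogB _ _ _ W; have dW := @whomog_sum _ _ _ W.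
apply: (component_ind (S := [set w | component (@whomog _ _ _ W) (ract w a) n =
  ract (component (@whomog _ _ _ W) w n) a]) (v := w) dW).
  by apply: eq_subgroup => v v'; rewrite ?ractB (component_morphB gW dW) ?ractB.
move=> p; have [Ww _ _] := component_decomposition w dW; move: (Ww p).
set v := component _ w p => Wv; rewrite /mkset.
rewrite (component_homog gW dW (whomog_ract a Wv)) (component_homog gW dW Wv).
by case: eqP => // _; rewrite ract0.
Qed.

(** * The actions of A_0 on L^0 and R^0 *)

Section L0Actions.
Variables (k : comPzRingType) (U : acsRing k).

Lemma piLB : {morph @piL k U :
  x y / x - y}. Proof. exact: (raddfB (qclass _)). Qed.
Lemma piRB : {morph @piR k U :
  x y / x - y}. Proof. exact: (raddfB (qclass _)). Qed.

Lemma piL_eq0 (x : U) : piL x = 0 <-> NL 1 x.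
Proof. by rewrite -(morphB_0 piLB) piLP subr0. Qed.

Lemma piA_eq0 (x : degree0 U) : piA x = 0 <-> NL 1 (incl0 x).
Proof. by rewrite -(morphB_0 (@piAB k U)) piAP -raddfB subr0. Qed.

Lemma L0_ractDl (u v : L0 U) a : L0_ract (u + v) a = L0_ract u a + L0_ract v a.
Proof.
rewrite -[u]piL_repr -[v]piL_repr -[a]piA_repr -piLD !L0_ract_pi.
by rewrite mulrDl piLD.
Qed.

Lemma L0_ract0l a : L0_ract (0 : L0 U) a = 0.
Proof. by apply: (addrI (L0_ract 0 a)); rewrite -L0_ractDl !addr0. Qed.

Lemma L0_ractDr (u : L0 U) a b : L0_ract u (a + b) = L0_ract u a + L0_ract u b.
Proof.
rewrite -[u]piL_repr -[a]piA_repr -[b]piA_repr.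
by rewrite -[X in L0_ract _ X]piAD !L0_ract_pi rmorphD mulrDr piLD.
Qed.

Lemma L0_ractA (u : L0 U) a b : L0_ract u (a * b) = L0_ract (L0_ract u a) b.
Proof.
rewrite -[u]piL_repr -[a]piA_repr -[b]piA_repr.
by rewrite -[X in L0_ract _ X]piAM !L0_ract_pi rmorphM mulrA.
Qed.

Lemma L0_ract1 (u : L0 U) : L0_ract u 1 = u.
Proof. by rewrite -[u]piL_repr [LHS]L0_ract_pi rmorph1 mulr1. Qed.

Lemma L0_ract_scale x (u : L0 U) a : L0_ract (x *: u) a = x *: L0_ract u a.
Proof.
by rewrite -[u]piL_repr -[a]piA_repr scale_piL !L0_ract_pi scale_piL mulrA.
Qed.

Lemma kin_piA c (a : degree0 U) :
  kin (zhu U) c * piA a = piA (Sub (kin U c) (kin_degree0 U c) * a).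
Proof. by rewrite [RHS]piAM. Qed.

Lemma L0_ract_kin c x a :
  L0_ract (piL (kin U c * x)) a = L0_ract (piL x) (kin (zhu U) c * a).
Proof.
rewrite -[a]piA_repr kin_piA !L0_ract_pi rmorphM.
by rewrite mulrA -kin_central.
Qed.

Lemma R0_lact1 (v : R0 U) : R0_lact 1 v = v.
Proof. by rewrite -[v]piR_repr [LHS]R0_lact_pi rmorph1 mul1r. Qed.

Lemma R0_lact_kin c x a :
  R0_lact a (piR (kin U c * x)) = R0_lact (kin (zhu U) c * a) (piR x).
Proof.
rewrite -[a]piA_repr kin_piA !R0_lact_pi rmorphM.
by rewrite mulrA -kin_central.
Qed.

End L0Actions.

Lemma homog_ind (k : comPzRingType) (U : gradedRing k) (S : set U) (x : U) :
  subgroup S -> (forall p y, homog p y -> S y) -> S x.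
Proof.
move=> gS Sh; apply: (component_ind (v := x) (@homog_sum k U) gS) => p.
by apply: (Sh p); have [] := component_decomposition x (@homog_sum k U).
Qed.

(** * Rationality and the strong identity condition *)

Section Semisimple.
Variables (k : comPzRingType) (U : acsRing k).
Hypothesis ratU : rational U (zhu U).

Let dU := @homog_sum k U.
Local Notation comp := (component (@whomog k U (zhu U) (Wmod U _))).

Let compB m p : {morph (fun w : Wmod U m => comp w p) : v w / v - w}.
Proof. exact: component_morphB (@whomogB _ _ _ _) (@whomog_sum _ _ _ _) p. Qed.

Let compZ m p q (x : U) (w : Wmod U m) : homog p x ->
  comp (x *: w) (p + q) = x *: comp w q.
Proof.
apply: component_scale; first exact: whomogB.
  exact: whomog_scale.
exact: whomog_sum.
Qed.

Let comp_homog m p (w : Wmod U m) : whomog p w ->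
  comp w = fun q => if q == p then w else 0.
Proof.
by move=> Ww; apply: component_homog Ww; [exact: whomogB|exact: whomog_sum].
Qed.

Let compP m p (w : Wmod U m) : whomog p (comp w p).
Proof. by have [] := component_decomposition w (@whomog_sum _ _ _ (Wmod U m)).
  Qed.

(** The multiplication map L^0 (x)_k A_0 -> L^0. Splitting it as a map of graded bimodules is the
    source of the separability of A_0. *)
Definition mu : Wmod U 1 -> L0 U := wlift (fun x a => L0_ract (piL x) a).

Fact mu_trilinear : trilinear 1 (fun x a => L0_ract (@piL k U x) a).
Proof.
split=> [x y a|x a b|c x a|x a /piL_eq0 ->].
- by rewrite piLD L0_ractDl.
- exact: L0_ractDr.
- exact: L0_ract_kin.
- exact: L0_ract0l.
Qed.

Lemma mu_wtens x a : mu (wtens 1 x a) = L0_ract (piL x) a.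
Proof. exact: (wlift_wtens mu_trilinear). Qed.

Lemma muB : {morph mu : v w / v - w}.
Proof. exact: (wliftB mu_trilinear). Qed.

(* The elements without trace in degree 0 form a subbimodule, any complement of
   which contains the degree 0 generator of W and hence is everything. *)
Lemma L0_cogenerated n (z : U) : homog n z ->
  (forall x : U, homog (- n) x -> NL 1 (x * z)) -> NL 1 z.
Proof.
move=> Uz Nz.
pose K : set (Wmod U 1) := [set w | forall x : U, comp (x *: w) 0 = 0].
have gK : graded_subbimodule K.
  split.
  - split=> [x|v w Kv Kw x]; first by rewrite scaler0 (morphB_0 (compB 0)).
    by rewrite scalerBr compB Kv Kw subrr.
  - by move=> x w Kw y; rewrite scalerA.
  - by move=> w a Kw x; rewrite -ract_scale component_ract Kw ract0.
  - move=> w p Kw x.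
    (* For [y] of degree [q], the vector [y *: comp w p] has degree [q + p]; if this is 0, it is the
       degree 0 component of [y *: w]. *)
    apply: (homog_ind (S := [set x | comp (x *: comp w p) 0 = 0]) x).
      split; first by rewrite /mkset scale0r (morphB_0 (compB 0)).
      by move=> y y'; rewrite /mkset scalerBl compB => -> ->; rewrite subrr.
    move=> q y Uy; rewrite /mkset (comp_homog (whomog_scale Uy (compP p w))).
    by case: eqP => // qp; rewrite -(compZ _ _ Uy) -qp.
have [C [[gC sC _ hC] KC KCT]] := rational_complement ratU gK.
(* Taking [x = 1] in [K] shows that [a] has no degree 0 component, so the generator, being of degree
   0, is the degree 0 component of [b]. *)
have C1 : C (wtens 1 1 1).
  have [a Ka [b Cb abE]] := KCT (wtens 1 1 1).
  have -> : wtens 1 1 1 = comp b 0; last exact: hC.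
  have := wtens_component 1 (1 : zhu U) (homog1 U) => /(congr1 (@^~ 0)) /= <-.
  by rewrite -abE (morphB_D (compB 0)) -[a]scale1r Ka add0r.
have Cz : C (wtens 1 z 1) by have := sC z _ C1; rewrite wtens_scale mulr1.
(* Only multipliers of degree [- n] bring [z] to degree 0, and for those the hypothesis applies. As
   [wtens 1 z 1] lies in [C] too, it vanishes. *)
have Kz : K (wtens 1 z 1).
  move=> x; rewrite wtens_scale.
  apply: (homog_ind (S := [set x | comp (wtens 1 (x * z) 1) 0 = 0]) x).
    apply: (preim_subgroup (f := fun x => comp (wtens 1 (x * z) 1) 0)
      (S := [set 0])); last by split=> // v w -> ->; rewrite /= subrr.
    by move=> y y'; rewrite mulrBl wtensB compB.
  move=> q y Uy; have Uyz := homogM Uy Uz.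
  rewrite /mkset (comp_homog (wtens_homog _ _ Uyz)); case: eqP => // qn.
  apply/wtens_NL/Nz; suff <- : q = - n by [].
  by apply/eqP; rewrite -addr_eq0 -qn.
apply/piL_eq0; rewrite -[piL z]L0_ract1 -mu_wtens.
have -> : wtens 1 z 1 = 0 by exact: KC.
exact: morphB_0 muB.
Qed.

(* The kernel of the multiplication map has a complement, which is a copy of
   L^0; the copy [e = \sum u_i (x) b_i] of 1 satisfies [x e = e x] for x of
   degree 0, and [t a] is the degree 0 part of [\sum u_i a b_i]. *)
Lemma central_trace : exists t : zhu U -> zhu U,
  [/\ {morph t : a b / a + b},
      forall c a, t (kin (zhu U) c * a) = kin (zhu U) c * t a,
      forall a b, b * t a = t a * b & t 1 = 1].
Proof.
pose K : set (Wmod U 1) := [set w | mu w = 0].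
have muZ x w : mu (x *: w) = x *: mu w.
  apply: (Wmod_ind (S := [set w | mu (x *: w) = x *: mu w])).
    by apply: eq_subgroup => v v'; rewrite ?scalerBr muB ?scalerBr.
  by move=> p y a _; rewrite /mkset wtens_scale !mu_wtens -L0_ract_scale
    scale_piL.
have mu_ract w a : mu (ract w a) = L0_ract (mu w) a.
  apply: (Wmod_ind (S := [set w | mu (ract w a) = L0_ract (mu w) a])).
    apply: eq_subgroup => v v'; rewrite ?ractB muB //.
    by apply: (addIr (L0_ract (mu v') a)); rewrite -L0_ractDl !subrK.
  by move=> p y b _; rewrite /mkset wtens_ract !mu_wtens L0_ractA.
have mu_comp w p : mu (comp w p) = component (@Lquot_homog k U 1) (mu w) p.
  have gL := @Lquot_homogB k U 1; have dL := @Lquot_homog_sum k U 1.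
  apply: (Wmod_ind (S := [set w |
    mu (comp w p) = component (@Lquot_homog k U 1) (mu w) p])).
    by apply: eq_subgroup => v v'; rewrite ?compB muB ?(component_morphB gL dL).
  move=> q y a Uy; rewrite /mkset (comp_homog (wtens_homog _ _ Uy)) mu_wtens.
  have UL : Lquot_homog q (L0_ract (piL y) a).
    rewrite -[a]piA_repr L0_ract_pi; exists (y * incl0 (repr a)) => //.
    by rewrite -[q]addr0; apply: homogM => //; exact: degree0P.
  rewrite (component_homog gL dL UL).
  by case: eqP; rewrite ?mu_wtens ?(morphB_0 muB).
have gK : graded_subbimodule K.
  split.
  - split; first exact: morphB_0 muB.
    by move=> v w; rewrite /K /mkset muB => -> ->; rewrite subrr.
  - by move=> x w; rewrite /K /mkset muZ => ->; rewrite scaler0.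
  - by move=> w a; rewrite /K /mkset mu_ract => ->; rewrite L0_ract0l.
  - move=> w p; rewrite /K /mkset mu_comp => ->.
    exact: (morphB_0 (component_morphB (@Lquot_homogB k U 1) (@Lquot_homog_sum
      k U 1) p)).
have [C [[gC sC rC _] KC KCT]] := rational_complement ratU gK.
have [z Kz [e Ce zeE]] := KCT (wtens 1 1 1).
have mu_e : mu e = piL 1.
  have := congr1 mu zeE; rewrite (morphB_D muB) Kz add0r => ->.
  by rewrite mu_wtens L0_ract1.
(* Both sides lie in [C] and have the same image under [mu], which is injective on [C]. *)
have e_central (x : degree0 U) : incl0 x *: e = ract e (piA x).
  apply/subr0_eq; apply: KC; split; last first.
    by apply: (proj2 gC); [exact: sC|exact: rC].
  rewrite /K /mkset muB muZ mu_ract mu_e scale_piL L0_ract_pi.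
  by rewrite mul1r mulr1 subrr.
(* Evaluated on e = \sum u_i (x) b_i, this gives \sum [u_i]_0 a b_i, the value of [t a]. *)
pose f a (x : U) b : zhu U := (piA (degree0_part x) : zhu U) * (a * b).
have f_tri a : trilinear 1 (f a).
  rewrite /f; split=> [x y b|x b c|c x b|x b Nx].
  - have dD := morphB_D (@degree0_partB k U).
    by rewrite dD [X in X * _]piAD mulrDl.
  - by rewrite !mulrDr.
  - have -> : degree0_part (kin U c * x) =
        Sub (kin U c) (kin_degree0 U c) * degree0_part x.
      exact: (degree0_part_mull x (Sub (kin U c) (kin_degree0 U c))).
    rewrite -kin_piA -!mulrA; rewrite kin_central -!mulrA.
    by congr (_ * (_ * _)); rewrite -kin_central.
  - by rewrite degree0_part_NL // mul0r.
pose t a := wlift (f a) e.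
(* Reduces an identity for [t a] to pure tensors: any additive map that agrees there with [f a] may
   be evaluated at [e] instead. *)
have tE (g : Wmod U 1 -> zhu U) a : {morph g : v w / v - w} ->
    (forall x b, f a x b = g (wtens 1 x b)) -> t a = g e.
  move=> gB fg; apply: (Wmod_ind (S := [set w | wlift (f a) w = g w])).
    by apply: eq_subgroup => //; exact: (wliftB (f_tri a)).
  by move=> p x b _; rewrite /mkset (wlift_wtens (f_tri a)).
exists t; split.
- move=> a b; apply: (tE (fun w => wlift (f a) w + wlift (f b) w)).
    by move=> v w; rewrite !(wliftB (f_tri _)) opprD addrACA.
  by move=> x c; rewrite !(wlift_wtens (f_tri _)) /f mulrDl mulrDr.
- move=> c a; apply: (tE (fun w => kin (zhu U) c * wlift (f a) w)).
    by move=> v w; rewrite (wliftB (f_tri _)) mulrBr.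
  by move=> x b; rewrite (wlift_wtens (f_tri _)) /f !mulrA kin_central.
- move=> a b; rewrite -[b]piA_repr; set x := repr b.
  (* The middle term has two evaluations: the left action of [x] on [e] produces a factor [b] on the
     left, and the right action, equal to it by [e_central], produces one on the right. *)
  transitivity (wlift (f a) (incl0 x *: e)).
    apply/esym; apply: (Wmod_ind (S := [set w |
      wlift (f a) (incl0 x *: w) = piA x * wlift (f a) w])).
      apply: eq_subgroup => v w; rewrite ?scalerBr !(wliftB (f_tri _)) //.
      by rewrite mulrBr.
    move=> p y c _; rewrite /mkset wtens_scale !(wlift_wtens (f_tri _)) /f.
    by rewrite degree0_part_mull [piA (_ * _)]piAM -mulrA.
  rewrite e_central /t; apply: (Wmod_ind (S := [set w : Wmod U 1 |
    wlift (f a) (ract w (piA x)) = wlift (f a) w * (piA x : zhu U)])).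
    apply: eq_subgroup => v w; rewrite ?ractB !(wliftB (f_tri _)) //.
    by rewrite mulrBl.
  by move=> p y c _; rewrite /mkset wtens_ract !(wlift_wtens (f_tri _)) /f
    -!mulrA.
(* For [a = 1] the degree 0 part is that of [mu e], which is the class of 1. *)
- have -> : t 1 = pairing (piR 1) (mu e).
    apply: (tE (fun w => pairing (piR 1) (mu w))) => [v w|x b].
      rewrite muB; apply: (addIr (pairing (piR 1) (mu w))).
      by rewrite -pairingDr !subrK.
    by rewrite mu_wtens pairing_ract pairing_pi /f !mul1r.
  rewrite mu_e pairing_pi mulr1; congr piA; apply: incl0_inj.
  by rewrite (degree0_part_homog (homog1 U)) eqxx rmorph1.
Qed.

(** Split the generator along U.W_{-n} and a complement, and let [w] be the degree 0 part of the
    first summand. An element of U_{-n} sends the other part into W_{-n} and also into the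
    complement, hence to 0. The index [n + 1] is chosen because right multiplication by U_n then
    maps into L^0, and N_L^{n+1} agrees with N_R^1 in degree -n. *)
Lemma generator_split (n : int) : exists w : Wmod U (n + 1),
  [/\ span [set v | exists (x y : U) (a : zhu U),
        [/\ homog n x, homog (- n) y & v = wtens (n + 1) (x * y) a]] w,
      whomog 0 w &
      forall z : U, homog (- n) z -> z *: (wtens (n + 1) 1 1 - w) = 0].
Proof.
set m := n + 1.
(* [X q] sits in degree [q - n], so only [X n] contributes to degree 0. Together the [X q] span
   U.W_{-n}. *)
pose X q : set (Wmod U m) := [set v | exists (x y : U) (a : zhu U),
  [/\ homog q x, homog (- n) y & v = wtens m (x * y) a]].
pose P : set (Wmod U m) := span (\bigcup_q X q).
have gP : subgroup P := span_subgroup _.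
have gen q v : X q v -> P v by move=> Xv; apply: span_gen; exists q.
have X_homog q v : X q v -> whomog (q - n) v.
  by move=> [x [y [a [Ux Uy ->]]]]; apply: wtens_homog; exact: homogM.
have P0 w : P w -> span (X n) (comp w 0).
  move: w; apply: span_ind.
    exact: (preim_subgroup (f :=
      fun w => comp w 0) (compB 0) (span_subgroup _)).
  move=> v [q _ Xv]; rewrite /preimage /mkset (comp_homog (X_homog _ _ Xv)).
  case: eqP => [/esym/eqP|_]; last exact: span_0.
  by rewrite subr_eq0 => /eqP <-; exact: span_gen.
have gbP : graded_subbimodule P.
  split=> //.
  - move=> x; apply: span_ind.
      by apply: (preim_subgroup (f := fun w => x *: w)) => // v w;
        exact: scalerBr.
    move=> v [q _ [y [b [a [Uy Ub ->]]]]]; rewrite /preimage /mkset wtens_scale.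
    apply: (homog_ind (S := [set x | P (wtens m (x * (y * b)) a)]) x).
      apply: (preim_subgroup (f :=
        fun x => wtens m (x * (y * b)) a)) => // x1 x2.
      by rewrite mulrBl wtensB.
    move=> p x1 Ux1; apply: (gen (p + q)); exists (x1 * y), b, a.
    by rewrite mulrA; split=> //; exact: homogM.
  - move=> w a; move: w; apply: span_ind.
      by apply: (preim_subgroup (f := fun w => ract w a)) => // v w;
        exact: ractB.
    move=> v [q _ [y [b [c [Uy Ub ->]]]]]; rewrite /preimage /mkset wtens_ract.
    by apply: (gen q); exists y, b, (c * a).
  - move=> w p; move: w; apply: span_ind.
      exact: (preim_subgroup (f := fun w => comp w p) (compB p) gP).
    move=> v [q _ Xv]; rewrite /preimage /mkset (comp_homog (X_homog _ _ Xv)).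
    by case: eqP => _; [exact: gen Xv|exact: span_0].
have PW w : whomog (- n) w -> P w.
  move: w; apply: span_ind => // _ [_ [b Ub <-] [a _ <-]].
  apply: (gen 0); exists 1, b, a.
  by rewrite mul1r; split=> //; exact: homog1.
have [C [[gC sC _ hC] PC PCT]] := rational_complement ratU gbP.
have [w Pw [c Cc wcE]] := PCT (wtens m 1 1).
exists (comp w 0); split; [exact: P0|exact: compP|] => z Uz.
have -> : wtens m 1 1 - comp w 0 = comp c 0.
  have := wtens_component m (1 : zhu U) (homog1 U) => /(congr1 (@^~ 0)) /= <-.
  by rewrite -wcE (morphB_D (compB 0)) addrC addKr.
apply: PC; split; last by apply/sC/hC.
apply: PW; rewrite -[- n]addr0.
by apply: whomog_scale => //; exact: compP.
Qed.

(** With [w] from [generator_split], [z] kills [w], since z x y lies in N_L^1 U_{-n}, contained in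
    N_L^{n+1} U; it kills the rest of the generator as well. So z (x) 1 = 0, and the class of [z] in
    R^0 is an image of this vector. *)
Lemma R0_cogenerated (n : int) (z : U) : homog (- n) z ->
  (forall g : U, homog n g -> NL 1 (z * g)) -> piR z = 0.
Proof.
move=> Uz Nz; have [w [Xw _ zw]] := generator_split n.
have w0 : z *: w = 0.
  move: w Xw {zw}; apply: span_ind.
    by apply: eq_subgroup => [v w|v w]; rewrite ?scalerBr ?subrr.
  move=> _ [x [y [a [Ux Uy ->]]]]; rewrite /mkset wtens_scale mulrA wtens_NL //.
  by have := NL_mulr_all (Nz x Ux) Uy; rewrite opprK addrC.
have z0 : wtens (n + 1) z 1 = 0.
  by have := zw z Uz; rewrite scalerBr w0 subr0 wtens_scale mulr1.
(* The map to R^0 that recovers the class of [z]; it descends since N_L^{n+1} U_{-n} = N_R^1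
   U_{-n}. *)
pose rho x a := R0_lact a (piR (component (@homog k U) x (- n))).
have cB := component_morphB (homogB U) dU (- n).
have rho_tri : trilinear (n + 1) rho.
  rewrite /rho; split=> [x y a|x a b|c x a|x a Nx].
  - by rewrite (morphB_D cB) piRD R0_lactDr.
  - exact: R0_lactDl.
  - rewrite -R0_lact_kin; congr (R0_lact _ (piR _)).
    have Uc : homog 0 (kin U c) by rewrite -[kin U c]mulr1; exact/homogZ/homog1.
    have := component_scale (M := U^o) (homogB U) (@homogM k U) dU (- n) x Uc.
    by rewrite add0r.
  - have -> : piR (component (@homog k U) x (- n)) = 0.
      rewrite -(morphB_0 (@piRB k U)); apply/piRP; rewrite subr0.
      apply: (homog_NR (p := - n)).
        by have [] := component_decomposition x dU.
      by rewrite opprK addrC; exact: NL_graded.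
    by apply: (addrI (R0_lact a 0)); rewrite -R0_lactDr !addr0.
have := congr1 (wlift rho) z0; rewrite (morphB_0 (wliftB rho_tri)).
rewrite (wlift_wtens rho_tri) /rho R0_lact1.
by rewrite (component_homog (homogB U) dU Uz) eqxx.
Qed.

(** * The actions of the mode transition algebra on L^0 and R^0 *)

Let mtaB_l (u w : L0 U) v : mta_tens (u - w) v = mta_tens u v - mta_tens w v.
Proof.
have [tDl _ _] := tens_balanced (@L0_ract k U) (@R0_lact k U).
by apply: (addIr (mta_tens w v)); rewrite -[LHS]tDl !subrK.
Qed.

Let mtaB_r u (v w : R0 U) : mta_tens u (v - w) = mta_tens u v - mta_tens u w.
Proof.
have [_ tDr _] := tens_balanced (@L0_ract k U) (@R0_lact k U).
by apply: (addIr (mta_tens u w)); rewrite -[LHS]tDr !subrK.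
Qed.

(** The left module structure of L^0 over the mode transition algebra; [star_actl] reduces left
    identity laws to it. *)
Definition mta_actl (s : mta U) (u : L0 U) : L0 U :=
  tensor_lift (fun u' v => L0_ract u' (pairing v u)) s.

(** The right module structure of R^0, to which [star_actr] reduces right identity laws. *)
Definition mta_actr (v : R0 U) (s : mta U) : R0 U :=
  tensor_lift (fun u v' => R0_lact (pairing v u) v') s.

Let actl_bal u : balanced (@L0_ract k U) (@R0_lact k U)
  (fun u' v => L0_ract u' (pairing v u)).
Proof.
split=> [v w x|v x y|v a x].
- exact: L0_ractDl.
- by rewrite pairingDl L0_ractDr.
- by rewrite pairing_lact L0_ractA.
Qed.

Let actr_bal v : balanced (@L0_ract k U) (@R0_lact k U)
  (fun u v' => R0_lact (pairing v u) v').
Proof.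
split=> [u w x|u x y|u a x].
- by rewrite pairingDr R0_lactDl.
- exact: R0_lactDr.
- by rewrite pairing_ract R0_lactA.
Qed.

Lemma mta_actl_tens u v w : mta_actl (mta_tens u v) w = L0_ract u (pairing v w).
Proof. exact: (tensor_lift_tens (actl_bal w)). Qed.

Lemma mta_actr_tens u v w : mta_actr w (mta_tens u v) = R0_lact (pairing w u) v.
Proof. exact: (tensor_lift_tens (actr_bal w)). Qed.

Lemma mta_actlB u : {morph mta_actl^~ u : s t / s - t}.
Proof. exact: (tensor_liftB (actl_bal u)). Qed.

Lemma mta_actrB v : {morph mta_actr v : s t / s - t}.
Proof. exact: (tensor_liftB (actr_bal v)). Qed.

Lemma star_actl s u v : star s (mta_tens u v) = mta_tens (mta_actl s u) v.
Proof.
apply: (tensor_ind (P := [set s | star s (mta_tens u v) =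
  mta_tens (mta_actl s u) v])).
  by apply: eq_subgroup => x y; rewrite ?starBl // mta_actlB mtaB_l.
move=> u' v'; rewrite /mkset -/(mta_tens u' v') star_tens mta_actl_tens.
by have [_ _ tA] := tens_balanced (@L0_ract k U) (@R0_lact k U);
  rewrite [RHS]tA.
Qed.

Lemma star_actr u v s : star (mta_tens u v) s = mta_tens u (mta_actr v s).
Proof.
apply: (tensor_ind (P := [set s | star (mta_tens u v) s =
  mta_tens u (mta_actr v s)])).
  by apply: eq_subgroup => x y; rewrite ?starBr // mta_actrB mtaB_r.
by move=> u' v'; rewrite /mkset -/(mta_tens u' v') star_tens mta_actr_tens.
Qed.

Let pairingBl v w u : pairing (v - w) u = pairing v u - pairing w u :> zhu U.
Proof. by apply: (addIr (pairing w u)); rewrite -pairingDl !subrK. Qed.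

(** On generators both sides are the product of two pairings, by A_0-linearity in each argument.
    This adjunction carries the identity property from L^0 over to R^0. *)
Lemma pairing_actr v s u : pairing (mta_actr v s) u = pairing v (mta_actl s u).
Proof.
apply: (tensor_ind (P := [set s |
  pairing (mta_actr v s) u = pairing v (mta_actl s u)])).
  apply: eq_subgroup => x y; first by rewrite mta_actrB pairingBl.
  rewrite mta_actlB; apply: (addIr (pairing v (mta_actl y u))).
  by rewrite -pairingDr !subrK.
move=> u' v'; rewrite /mkset -/(mta_tens u' v') mta_actl_tens mta_actr_tens.
by rewrite pairing_lact pairing_ract.
Qed.

Let R0_homogB p : subgroup (@R0_homog k U p).
Proof.
split; first by exists 0; [exact: (proj1 (homogB U p))|exact: morphB_0 (@piRB
  k U)].
move=> _ _ [x Ux <-] [y Uy <-]; exists (x - y); last exact: piRB.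
exact: (proj2 (homogB U p)).
Qed.

Lemma mta_actr_homog v p q s : mta_homog p q s -> R0_homog q (mta_actr v s).
Proof.
move: s; apply: span_ind.
  exact: (preim_subgroup (@mta_actrB v) (R0_homogB q)).
move=> _ [u _ [_ [y Uy <-] <-]]; rewrite /preimage /mkset mta_actr_tens.
rewrite -[pairing v u]piA_repr R0_lact_pi.
exists (incl0 (repr (pairing v u)) * y) => //.
by rewrite -[q]add0r; apply: homogM => //; exact: degree0P.
Qed.

(** The element [s] is read off from the [w] of [generator_split] by means of the central trace. The
    defect is the image of a vector killed by U_{-n}, so U_{-n} kills it in L^0_n and it vanishes by
    [L0_cogenerated]. *)
Lemma identity_exists (n : int) : exists2 s : mta U,
  mta_homog n (- n) s & forall g : U, homog n g -> mta_actl s (piL g) = piL g.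
Proof.
have [t [tD t_kin t_central t1]] := central_trace.
have [w [Xw Ww zw]] := generator_split n.
(* Right multiplication by [g] in U_n carries N_L^{n+1} into N_L^1, so [theta g] descends to
   [Wmod U (n + 1)]. *)
pose theta g (x : U) a := L0_ract (piL (x * g)) (t a).
have theta_tri g : homog n g -> trilinear (n + 1) (theta g).
  rewrite /theta => Ug; split=> [x y a|x a b|c x a|x a Nx].
  - by rewrite mulrDl piLD L0_ractDl.
  - by rewrite tD L0_ractDr.
  - by rewrite t_kin -mulrA L0_ract_kin.
  - have -> : piL (x * g) = 0; last exact: L0_ract0l.
    by apply/piL_eq0; have := NL_mulr_all Nx Ug; rewrite addrAC subrr add0r.
(* One [s] must serve all [g] at once, so it is built by induction on the span containing [w],
   before any [g] is chosen. *)
have [s sn sE] : exists2 s : mta U, mta_homog n (- n) s &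
    forall g : U, homog n g -> mta_actl s (piL g) = wlift (theta g) w.
  move: w Xw {Ww zw}; apply: span_ind.
    split=> [|v w [s sn sE] [s' sn' sE']].
      exists 0; first exact: span_0.
      by move=> g Ug; rewrite (morphB_0 (mta_actlB _)) (morphB_0 (wliftB
        (theta_tri g Ug))).
    exists (s - s'); first exact: span_sub.
    by move=> g Ug; rewrite mta_actlB (wliftB (theta_tri g Ug)) sE // sE'.
  move=> _ [x [y [a [Ux Uy ->]]]].
  exists (mta_tens (L0_ract (piL x) (t a)) (piR y)).
    apply: span_gen; exists (L0_ract (piL x) (t a)).
      rewrite -[t a]piA_repr L0_ract_pi; exists (x * incl0 (repr (t a))) => //.
      by rewrite -[n]addr0; apply: homogM => //; exact: degree0P.
    by exists (piR y) => //; exists y.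
  move=> g Ug; rewrite mta_actl_tens (wlift_wtens (theta_tri g Ug)) /theta.
  (* Centrality moves [t a] past the class of [y * g], which has degree 0 and so is its own degree 0
     part. *)
  rewrite -L0_ractA pairing_pi -t_central L0_ractA L0_ract_pi.
  have Uyg : homog (- n + n) (y * g) := homogM Uy Ug.
  by rewrite (degree0_part_homog Uyg) addNr eqxx mulrA.
exists s => // g Ug; rewrite sE //.
have tB := wliftB (theta_tri g Ug).
have -> : wlift (theta g) w =
    wlift (theta g) (wtens (n + 1) 1 1) - wlift (theta g) (wtens (n + 1) 1 1 -
      w).
  by rewrite tB subKr.
rewrite (wlift_wtens (theta_tri g Ug)) /theta t1 mul1r L0_ract1 -/(theta g).
set v := wtens _ _ _ - w in zw *;
  suff -> : wlift (theta g) v = 0 by rewrite subr0.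
have thetaZ (x : U) (u : Wmod U (n + 1)) :
  wlift (theta g) (x *: u) = x *: wlift (theta g) u.
  apply: (Wmod_ind (S := [set u | wlift (theta g) (x *: u) =
    x *: wlift (theta g) u])).
    by apply: eq_subgroup => y y'; rewrite ?scalerBr tB ?scalerBr.
  move=> p y a _; rewrite /mkset wtens_scale !(wlift_wtens (theta_tri g Ug))
    /theta.
  by rewrite -L0_ract_scale scale_piL mulrA.
(* [L0_cogenerated] needs a homogeneous representative: [v] has degree 0, and [theta g] raises
   degrees by [n]. *)
have theta_homog : @whomog _ _ _ (Wmod U (n + 1)) 0 `<=` wlift (theta g) @^-1`
  L0_homog (0 + n).
  apply: span_ind; first exact: (preim_subgroup tB (@Lquot_homogB k U 1 _)).
  move=> _ [_ [x Ux <-] [a _ <-]]; rewrite /preimage /mkset.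
  rewrite [wlift _ _](wlift_wtens (theta_tri g Ug)) /theta -[t a]piA_repr
    L0_ract_pi.
  exists (x * g * incl0 (repr (t a))) => //; rewrite -[0 + n]addr0.
  by apply: homogM; [exact: homogM|exact: degree0P].
have [z Uz zE] : L0_homog (0 + n) (wlift (theta g) v).
  apply: theta_homog; apply: (proj2 (@whomogB _ _ _ (Wmod U (n + 1)) 0)) => //.
  exact: wtens_homog (homog1 U).
rewrite add0r in Uz; rewrite -zE; apply/piL_eq0;
  apply: (L0_cogenerated Uz) => x Ux.
by apply/piL_eq0; rewrite -scale_piL zE -thetaZ zw // (morphB_0 tB).
Qed.

(** The left law is the identity property on L^0. For the right law, the difference of a class in
    R^0_{-m} and its product with [one m] pairs to 0 with L^0_m by [pairing_actr], so it vanishes by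
    [R0_cogenerated]. *)
Lemma rational_strong_identity : strong_identity U.
Proof.
have /choice[one oneP] : forall n : nat, exists s : mta U,
    mta_homog n (- n%:Z) s /\
    forall g : U, homog n g -> mta_actl s (piL g) = piL g.
  by move=> n; have [s sn sE] := identity_exists n; exists s.
exists one; split=> [n|n m a an]; first by have [] := oneP n.
have [onen idl] := oneP n; have [onem idr] := oneP m.
move: a an; apply: span_ind.
  split=> [|a b [la ra] [lb rb]].
    split; first by rewrite -(subrr 0) starBr !subrr.
    by rewrite -(subrr 0) starBl !subrr.
  by rewrite /mkset starBr starBl la ra lb rb.
move=> _ [_ [x Ux <-] [_ [y Uy <-] <-]]; split; first by rewrite star_actl idl.
rewrite star_actr; congr mta_tens; apply/esym/subr0_eq.
have [z Uz zE] : R0_homog (- m%:Z) (piR y - mta_actr (piR y) (one m)).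
  by apply: (proj2 (R0_homogB _)); [exists y|exact: mta_actr_homog onem].
rewrite -zE; apply: (R0_cogenerated Uz) => g Ug.
suff : piA (degree0_part (z * g)) = 0.
  move/piA_eq0; rewrite (degree0_part_homog (homogM Uz Ug)).
  by rewrite addNr eqxx.
by rewrite -pairing_pi zE pairingBl pairing_actr idr // subrr.
Qed.

End Semisimple.

Theorem theorem9p13 (k : comPzRingType) (U : acsRing k) :
  rational U (zhu U) -> strong_identity U.
Proof. exact: rational_strong_identity. Qed.
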